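(* Let $M,N$ be complete pointed metric spaces and let $f\in \mathrm{Lip}_0(M,N)$. The following assertions are equivalent. (i) $\widehat f^{**}$ is injective. (ii) $f$ is injective and $\ker \widehat f^{**}\subset \mathcal F(M)$. (iii) $f$ is injective and $\widehat f$ is tauberian. (iv) $f$ is bi-Lipschitz. (v) $\widehat f$ is injective with closed range. (vi) $C_f$ is onto. (vii) $C_f$ has dense range.
   Context: A pointed metric space is a metric space with a distinguished base point $0$. $\mathrm{Lip}_0(M,N)$ is the set of Lipschitz maps $f\colon M\to N$ with $f(0)=0$; $\mathrm{Lip}_0(M)=\mathrm{Lip}_0(M,\mathbb R)$ is a Banach space for the norm $\|f\|_L$ = best Lipschitz constant of $f$. For $x\in M$, $\delta(x)\in \mathrm{Lip}_0(M)^*$ is the evaluation $\langle f,\delta(x)\rangle=f(x)$. The Lipschitz-free space $\mathcal F(M)$ is the norm-closed linear span of $\{\delta(x):x\in M\}$ in $\mathrm{Lip}_0(M)^*$; one has $\mathcal F(M)^*=\mathrm{Lip}_0(M)$ isometrically. For $f\in \mathrm{Lip}_0(M,N)$, $\widehat f\colon \mathcal F(M)\to\mathcal F(N)$ is the unique bounded linear operator with $\widehat f(\delta(x))=\delta(f(x))$ for all $x\in M$; $\widehat f^{**}\colon\mathcal F(M)^{**}\to\mathcal F(N)^{**}$ is its bi-adjoint. $C_f\colon \mathrm{Lip}_0(N)\to \mathrm{Lip}_0(M)$ is the composition operator $C_f(g)=g\circ f$ (it is the adjoint of $\widehat f$); ''dense range'' refers to the norm topology. $f$ is bi-Lipschitz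 if there are $a,b>0$ with $a\,d(x,y)\le d(f(x),f(y))\le b\,d(x,y)$ for all $x,y\in M$. A bounded operator $T\colon X\to Y$ between Banach spaces is tauberian if $(T^{**})^{-1}(Y)\subset X$, where $X\subset X^{**}$ and $Y\subset Y^{**}$ canonically. *)

(* Defs.v *)
From HB Require Import structures.
From mathcomp Require Import all_boot all_order all_algebra.
From mathcomp Require Import all_classical all_reals all_analysis.
Import Order.TTheory GRing.Theory Num.Theory.
Import numFieldNormedType.Exports.

Set Implicit Arguments.
Unset Strict Implicit.
Unset Printing Implicit Defensive.

Local Open Scope classical_set_scope.
Local Open Scope ring_scope.

(* Pointed metric spaces: the base point is [point]. *)
#[short(type="pMetricType")]
HB.structure Definition PointedMetric (K : numDomainType) :=
  {T of Metric K T & isPointed T}.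

#[short(type="completePMetricType")]
HB.structure Definition CompletePointedMetric (K : numDomainType) :=
  {T of Metric K T & Complete T}.

HB.instance Definition _ (K : numFieldType) := Metric.on K^o.

Section best_constant.
Context {R : realType} {I : Type}.
Implicit Types p q w : I -> R.

(* The least k >= 0 with p i <= k * w i for all i, when [dominated p w]. *)
Definition best_const p w : R :=
  inf [set k | 0 <= k /\ forall i, p i <= k * w i].

Definition dominated p w : Prop :=
  exists k, 0 <= k /\ forall i, p i <= k * w i.

Lemma best_const_lb p w k : 0 <= k -> (forall i, p i <= k * w i) ->
  best_const p w <= k.
Proof.
move=> k0 kP; apply: ge_inf; last by split.
by exists 0 => y [].
Qed.

Lemma best_const_ge0 p w : 0 <= best_const p w.
Proof.
have [[k kP]|nP] := pselect (dominated p w).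
  by apply: lb_le_inf; [exists k|move=> y []].
rewrite /best_const (_ : [set _ | _] = set0) ?inf0//.
by apply/seteqP; split => // k kP; case: nP; exists k.
Qed.

Lemma best_constP p w : (forall i, 0 <= w i) -> dominated p w ->
  forall i, p i <= best_const p w * w i.
Proof.
move=> w0 [k kP] i; have := w0 i; rewrite le_eqVlt => /orP[/eqP wi0|wi0].
  by have := kP.2 i; rewrite -wi0 !mulr0.
rewrite -ler_pdivrMr//; apply: lb_le_inf; first by exists k.
by move=> y [y0 yP]; rewrite ler_pdivrMr.
Qed.

Lemma best_constD p q r w : (forall i, 0 <= w i) ->
  dominated p w -> dominated q w -> (forall i, r i <= p i + q i) ->
  best_const r w <= best_const p w + best_const q w.
Proof.
move=> w0 pw qw rpq; apply: best_const_lb => [|i].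
  by rewrite addr_ge0// best_const_ge0.
by rewrite (le_trans (rpq i))// mulrDl lerD// best_constP.
Qed.

Lemma best_constZ p q w (l : R) : (forall i, 0 <= w i) -> dominated p w ->
  (forall i, q i = `|l| * p i) -> best_const q w = `|l| * best_const p w.
Proof.
move=> w0 pw qE; have qw : dominated q w.
  case: pw => k [k0 kP]; exists (`|l| * k); split; first by rewrite mulr_ge0.
  by move=> i; rewrite qE -mulrA ler_wpM2l.
apply/eqP; rewrite eq_le; apply/andP; split.
  apply: best_const_lb => [|i]; first by rewrite mulr_ge0// best_const_ge0.
  by rewrite qE -mulrA ler_wpM2l// best_constP.
have [->|l0] := eqVneq l 0; first by rewrite normr0 mul0r best_const_ge0.
have l0' : 0 < `|l| by rewrite normr_gt0.
rewrite mulrC -ler_pdivlMr//; apply: best_const_lb => [|i].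
  by rewrite divr_ge0// best_const_ge0.
have := best_constP w0 qw i.
by rewrite qE mulrAC ler_pdivlMr// mulrC.
Qed.

End best_constant.

Section lip0.
Context {R : realType}.
Implicit Types M N P : pMetricType R.

Definition is_lip0 M N (f : M -> N) : Prop :=
  (exists k, 0 <= k /\ forall x y, mdist (f x) (f y) <= k * mdist x y) /\
  f point = point.

Definition lip0_pred M N : {pred M -> N} := fun f => `[< is_lip0 f >].

Record lip0 M N := Lip0 {
  lip0_fun :> M -> N ;
  _ : lip0_fun \in @lip0_pred M N }.

HB.instance Definition _ M N := [isSub for @lip0_fun M N].
HB.instance Definition _ M N := [Choice of lip0 M N by <:].

Definition mk_lip0 M N (f : M -> N) (fP : is_lip0 f) : lip0 M N :=
  Lip0 (asboolT fP : f \in @lip0_pred M N).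

Lemma lip0P M N (f : lip0 M N) : is_lip0 f.
Proof. by case: f => f /= /asboolP. Qed.

Lemma lip0_ext M N (f g : lip0 M N) : f =1 g -> f = g.
Proof. by move=> fg; apply/val_inj/funext. Qed.

Lemma lip0_comp_subproof M N P (g : lip0 N P) (f : lip0 M N) :
  is_lip0 (g \o f).
Proof.
have [[k [k0 kP]] f0] := lip0P f; have [[l [l0 lP]] g0] := lip0P g.
split; last by rewrite /= f0 g0.
exists (l * k); split; first by rewrite mulr_ge0.
by move=> x y /=; rewrite (le_trans (lP _ _))// -mulrA ler_wpM2l.
Qed.

Definition lip0_comp M N P (g : lip0 N P) (f : lip0 M N) : lip0 M P :=
  mk_lip0 (lip0_comp_subproof g f).

End lip0.

Section lip0_real.
Context {R : realType}.
Implicit Types M N : pMetricType R.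

Lemma point_real : (point : R^o) = 0.
Proof. by []. Qed.

Lemma mdist_real (x y : R^o) : mdist x y = `|x - y|.
Proof. by rewrite distrC. Qed.

Lemma lip0_submod_closed M : GRing.submod_closed (@lip0_pred R M R^o).
Proof.
split.
  apply/asboolP; split => //; exists 0; split => // x y.
  by rewrite mdistxx mul0r.
move=> a f g /asboolP[[k [k0 kP]] f0] /asboolP[[l [l0 lP]] g0].
apply/asboolP; split; last first.
  rewrite -[LHS]/(a * f point + g point) f0 g0 point_real.
  by rewrite mulr0 addr0.
exists (`|a| * k + l); split; first by rewrite addr_ge0// mulr_ge0.
move=> x y; rewrite mdist_real.
rewrite -[X in `|X|]/((a * f x + g x) - (a * f y + g y)).
rewrite opprD addrACA -mulrBr (le_trans (ler_normD _ _))// normrM.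
rewrite mulrDl lerD//; last by rewrite -mdist_real.
by rewrite -mulrA ler_wpM2l// -mdist_real.
Qed.

HB.instance Definition _ M :=
  GRing.isSubmodClosed.Build R (M -> R^o) (@lip0_pred R M R^o)
    (lip0_submod_closed M).
HB.instance Definition _ M :=
  [SubChoice_isSubLmodule of lip0 M R^o by <:].

(* Lip_0(M) is [lip0 M R^o]; its norm is the best Lipschitz constant. *)
Definition lip_norm M (f : lip0 M R^o) : R :=
  best_const (fun xy : M * M => mdist (f xy.1) (f xy.2))
             (fun xy : M * M => mdist xy.1 xy.2).

Lemma lip_normP M (f : lip0 M R^o) x y :
  `|f x - f y| <= lip_norm f * mdist x y.
Proof.
have [[k [k0 kP]] _] := lip0P f; rewrite -mdist_real.
apply: (@best_constP _ _ (fun xy : M * M => mdist (f xy.1) (f xy.2))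
  (fun xy : M * M => mdist xy.1 xy.2) _ _ (x, y)).
  by move=> xy; exact: mdist_ge0.
by exists k; split => // -[].
Qed.

Lemma lip_norm_dom M (f : lip0 M R^o) :
  dominated (fun xy : M * M => mdist (f xy.1) (f xy.2))
            (fun xy : M * M => mdist xy.1 xy.2).
Proof. by have [[k [k0 kP]] _] := lip0P f; exists k; split => // -[]. Qed.

Lemma lip_normD M (f g : lip0 M R^o) :
  lip_norm (f + g) <= lip_norm f + lip_norm g.
Proof.
apply: best_constD; [|exact: lip_norm_dom|exact: lip_norm_dom|].
  by move=> xy; exact: mdist_ge0.
move=> [x y] /=; rewrite !mdist_real.
rewrite -[X in `|X|]/((f x + g x) - (f y + g y)).
by rewrite opprD addrACA ler_normD.
Qed.

Lemma lip_normZ M (l : R) (f : lip0 M R^o) :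
  lip_norm (l *: f) = `|l| * lip_norm f.
Proof.
apply: best_constZ; [|exact: lip_norm_dom|].
  by move=> xy; exact: mdist_ge0.
move=> [x y] /=; rewrite !mdist_real -normrM mulrBr.
by rewrite -[X in `|X|]/(l * f x - l * f y).
Qed.

Lemma lip_norm_eq0 M (f : lip0 M R^o) : lip_norm f = 0 -> f = 0.
Proof.
move=> f0; apply: lip0_ext => x.
have := lip_normP f x point.
rewrite f0 mul0r normr_le0 subr_eq0 => /eqP ->.
by have [_ ->] := lip0P f.
Qed.

HB.instance Definition _ M := Lmodule_isNormed.Build R (lip0 M R^o)
  (@lip_normD M) (@lip_normZ M) (@lip_norm_eq0 M).

Lemma lip0_normE M (f : lip0 M R^o) : `|f| = lip_norm f.
Proof. by []. Qed.

End lip0_real.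

Section bounded_op.
Context {R : realType}.
Implicit Types V W : normedModType R.

Definition bop_pred V W : {pred V -> W} :=
  fun T => `[< linear T /\ continuous T >].

Record bounded_op V W := BoundedOp {
  bop_fun :> V -> W ;
  _ : bop_fun \in @bop_pred V W }.

HB.instance Definition _ V W := [isSub for @bop_fun V W].
HB.instance Definition _ V W := [Choice of bounded_op V W by <:].

Lemma bop_linear V W (T : bounded_op V W) : linear T.
Proof. by case: T => T /= /asboolP[]. Qed.

HB.instance Definition _ V W (T : bounded_op V W) :=
  GRing.isLinear.Build R V W *:%R (bop_fun T) (bop_linear T).

Lemma bop_continuous V W (T : bounded_op V W) : continuous T.
Proof. by case: T => T /= /asboolP[]. Qed.

Lemma bop_ext V W (S T : bounded_op V W) : S =1 T -> S = T.
Proof. by move=> ST; apply/val_inj/funext. Qed.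

Lemma mk_bop_subproof V W (T : V -> W) : linear T ->
  (exists k, 0 <= k /\ forall v, `|T v| <= k * `|v|) ->
  T \in @bop_pred V W.
Proof.
move=> lT [k [k0 kP]]; apply/asboolP; split=> //.
pose T' := GRing.isLinear.Build R V W *:%R T lT.
pose TL : {linear V -> W} := HB.pack T T'.
apply: (@bounded_linear_continuous _ _ _ TL); apply/linear_boundedP.
exists k; split; first exact: ger0_real.
by move=> r kr v; rewrite (le_trans (kP v))// ler_wpM2r// ltW.
Qed.

Definition mk_bop V W (T : V -> W) (lT : linear T)
    (bT : exists k, 0 <= k /\ forall v, `|T v| <= k * `|v|) :
    bounded_op V W :=
  BoundedOp (mk_bop_subproof lT bT).

Lemma bop_submod_closed V W : GRing.submod_closed (@bop_pred V W).
Proof.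
split.
  apply/asboolP; split; last exact: cst_continuous.
  by move=> a u v; rewrite -[LHS]/(0 : W) scaler0 addr0.
move=> a S T /asboolP[lS cS] /asboolP[lT cT].
apply/asboolP; split => [b u v|x].
  rewrite -[LHS]/(a *: S (b *: u + v) + T (b *: u + v)) lS lT.
  rewrite -[RHS]/(b *: (a *: S u + T u) + (a *: S v + T v)).
  by rewrite !scalerDr !scalerA (mulrC b) addrACA.
by apply: cvgD; [apply: cvgZl_tmp; exact: cS|exact: cT].
Qed.

HB.instance Definition _ V W :=
  GRing.isSubmodClosed.Build R (V -> W) (@bop_pred V W)
    (bop_submod_closed V W).
HB.instance Definition _ V W :=
  [SubChoice_isSubLmodule of bounded_op V W by <:].

Definition op_norm V W (T : bounded_op V W) : R :=
  best_const (fun v => `|T v|) (fun v => `|v|).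

Lemma op_norm_dom V W (T : bounded_op V W) :
  dominated (fun v => `|T v|) (fun v => `|v|).
Proof.
have /linear_bounded_continuous/linear_boundedP := @bop_continuous _ _ T.
by move=> /pinfty_ex_gt0[k k0 kP]; exists k; split => //; exact: ltW.
Qed.

Lemma op_normP V W (T : bounded_op V W) v : `|T v| <= op_norm T * `|v|.
Proof.
apply: (best_constP (p := fun v => `|T v|) (w := fun v => `|v|)) => //.
exact: op_norm_dom.
Qed.

Lemma op_norm_ge0 V W (T : bounded_op V W) : 0 <= op_norm T.
Proof. exact: best_const_ge0. Qed.

Lemma op_normD V W (S T : bounded_op V W) :
  op_norm (S + T) <= op_norm S + op_norm T.
Proof.
apply: best_constD => //; [exact: op_norm_dom|exact: op_norm_dom|].
by move=> v; exact: ler_normD.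
Qed.

Lemma op_normZ V W (l : R) (T : bounded_op V W) :
  op_norm (l *: T) = `|l| * op_norm T.
Proof.
apply: best_constZ => //; first exact: op_norm_dom.
by move=> v; exact: normrZ.
Qed.

Lemma op_norm_eq0 V W (T : bounded_op V W) : op_norm T = 0 -> T = 0.
Proof.
move=> T0; apply: bop_ext => v.
by have := op_normP T v; rewrite T0 mul0r normr_le0 => /eqP.
Qed.

HB.instance Definition _ V W := Lmodule_isNormed.Build R (bounded_op V W)
  (@op_normD V W) (@op_normZ V W) (@op_norm_eq0 V W).

Lemma bop_normE V W (T : bounded_op V W) : `|T| = op_norm T.
Proof. by []. Qed.

End bounded_op.

Notation dual V := (bounded_op V (GRing.regular _)).

Section adjoint.
Context {R : realType}.
Implicit Types V W : normedModType R.

Lemma adjoint_val_subproof V W (T : bounded_op V W) (phi : dual W) :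
  phi \o T \in @bop_pred R V R^o.
Proof.
apply/asboolP; split; first by move=> a u v /=; rewrite !linearP.
move=> x; apply: continuous_comp; exact: bop_continuous.
Qed.

Definition adjoint_val V W (T : bounded_op V W) (phi : dual W) : dual V :=
  BoundedOp (adjoint_val_subproof T phi).

Lemma adjoint_linear V W (T : bounded_op V W) : linear (adjoint_val T).
Proof. by move=> a phi psi; apply: bop_ext. Qed.

Lemma adjoint_bounded V W (T : bounded_op V W) :
  exists k, 0 <= k /\ forall phi, `|adjoint_val T phi| <= k * `|phi|.
Proof.
exists (op_norm T); split; first exact: op_norm_ge0.
move=> phi; apply: best_const_lb => [|v] /=.
  by rewrite mulr_ge0// op_norm_ge0.
rewrite (le_trans (op_normP phi (T v)))//.
have := ler_wpM2l (op_norm_ge0 phi) (op_normP T v).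
by move=> /le_trans; apply; rewrite mulrA bop_normE [op_norm T * _]mulrC.
Qed.

Definition adjoint V W (T : bounded_op V W) : bounded_op (dual W) (dual V) :=
  mk_bop (adjoint_linear T) (adjoint_bounded T).

Lemma adjointE V W (T : bounded_op V W) (phi : dual W) v :
  adjoint T phi v = phi (T v).
Proof. by []. Qed.

Lemma bidual_val_linear V (v : V) : linear (fun phi : dual V => phi v).
Proof. by []. Qed.

Lemma bidual_val_bounded V (v : V) :
  exists k, 0 <= k /\ forall phi : dual V, `|phi v| <= k * `|phi|.
Proof.
exists `|v|; split => [|phi]; first exact: normr_ge0.
by rewrite mulrC; exact: op_normP.
Qed.

Definition bidual_emb V (v : V) : dual (dual V) :=
  mk_bop (bidual_val_linear v) (bidual_val_bounded v).

Lemma bidual_embE V (v : V) (phi : dual V) : bidual_emb v phi = phi v.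
Proof. by []. Qed.

Definition biadjoint V W (T : bounded_op V W) :
    bounded_op (dual (dual V)) (dual (dual W)) :=
  adjoint (adjoint T).

Definition tauberian V W (T : bounded_op V W) : Prop :=
  biadjoint T @^-1` range (@bidual_emb W) `<=` range (@bidual_emb V).

End adjoint.

Section closed_span.
Context {R : realType} {V : normedModType R}.
Implicit Types A : set V.

Definition lin_span A : set V :=
  [set v | exists s : seq (R * V), (forall p, p \in s -> A p.2) /\
    v = \sum_(p <- s) p.1 *: p.2].

Definition closed_span A : set V := closure (lin_span A).

Lemma lin_span0 A : lin_span A 0.
Proof. by exists [::]; rewrite big_nil. Qed.

Lemma lin_spanP A a u v : lin_span A u -> lin_span A v ->
  lin_span A (a *: u + v).
Proof.
move=> [s [sA ->]] [t [tA ->]].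
exists ([seq (a * p.1, p.2) | p <- s] ++ t); split.
  move=> p; rewrite mem_cat => /orP[/mapP[q qs ->]|/tA//].
  exact: (sA q).
rewrite big_cat big_map scaler_sumr; congr (_ + _).
by apply: eq_bigr => p _; rewrite scalerA.
Qed.

Lemma closureP_norm A v : closure A v <->
  forall e, 0 < e -> exists2 a, A a & `|v - a| < e.
Proof.
split=> [cl e e0|cl B /nbhs_ballP[e /= e0 eB]].
  have [a [Aa]] := cl _ (nbhsx_ballx v e e0).
  by rewrite -ball_normE /= => va; exists a.
have [a Aa va] := cl e e0.
by exists a; split => //; apply: eB; rewrite -ball_normE.
Qed.

Lemma closed_span0 A : closed_span A 0.
Proof. exact/subset_closure/lin_span0. Qed.

Lemma closed_span_sub A : A `<=` closed_span A.
Proof.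
move=> a Aa; apply: subset_closure; exists [:: (1, a)]; split.
  by move=> p; rewrite inE => /eqP ->.
by rewrite big_seq1 scale1r.
Qed.

Lemma closed_spanP A a u v : closed_span A u -> closed_span A v ->
  closed_span A (a *: u + v).
Proof.
move=> /closureP_norm uA /closureP_norm vA; apply/closureP_norm => e e0.
have [u' u'A uu'] := uA (e / 2 / (`|a| + 1)) ltac:(by rewrite !divr_gt0 ?ltr_wpDl).
have [v' v'A vv'] := vA (e / 2) ltac:(by rewrite divr_gt0).
exists (a *: u' + v'); first exact: lin_spanP.
rewrite opprD addrACA -scalerBr (splitr e).
rewrite (le_lt_trans (ler_normD _ _))// ler_ltD// normrZ.
move: uu'; rewrite ltr_pdivlMr ?ltr_wpDl// mulrDr mulr1 => /ltW.
by apply: le_trans; rewrite mulrC lerDl.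
Qed.

Lemma closed_span_ind A (P : V -> Prop) : closed P ->
  P 0 -> (forall a u v, A u -> P v -> P (a *: u + v)) ->
  closed_span A `<=` P.
Proof.
move=> cP P0 PD v /(closure_subset (B := P)) vP.
rewrite [P](iffLR (closure_id _))//; apply: vP => {v} v [s [sA ->]].
elim: s sA => [|p s IHs] sA; first by rewrite big_nil.
rewrite big_cons; apply: PD; first by apply: sA; rewrite mem_head.
by apply: IHs => q qs; apply: sA; rewrite in_cons qs orbT.
Qed.

End closed_span.

Section lipfree.
Context {R : realType}.
Implicit Types M N : pMetricType R.

Lemma lip_delta_linear M (x : M) : linear (fun f : lip0 M R^o => (f x : R^o)).
Proof. by []. Qed.

Lemma lip_delta_bounded M (x : M) :
  exists k, 0 <= k /\ forall f : lip0 M R^o, `|f x : R^o| <= k * `|f|.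
Proof.
exists (mdist x point); split=> [|f]; first exact: mdist_ge0.
by have := lip_normP f x point; rewrite (lip0P f).2 subr0 mulrC.
Qed.

Definition lip_delta M (x : M) : dual (lip0 M R^o) :=
  mk_bop (lip_delta_linear x) (lip_delta_bounded x).

Lemma lip_deltaE M (x : M) (f : lip0 M R^o) : lip_delta x f = f x.
Proof. by []. Qed.

Definition lipfree_pred M : {pred dual (lip0 M R^o)} :=
  fun phi => `[< closed_span (range (@lip_delta M)) phi >].

Record lipfree M := Lipfree {
  lipfree_val :> dual (lip0 M R^o) ;
  _ : lipfree_val \in @lipfree_pred M }.

HB.instance Definition _ M := [isSub for @lipfree_val M].
HB.instance Definition _ M := [Choice of lipfree M by <:].

Lemma lipfree_submod_closed M : GRing.submod_closed (@lipfree_pred M).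
Proof.
split; first exact/asboolP/closed_span0.
by move=> a u v /asboolP Fu /asboolP Fv; exact/asboolP/closed_spanP.
Qed.

HB.instance Definition _ M :=
  GRing.isSubmodClosed.Build R (dual (lip0 M R^o)) (@lipfree_pred M)
    (lipfree_submod_closed M).
HB.instance Definition _ M :=
  [SubChoice_isSubLmodule of lipfree M by <:].

Definition lipfree_norm M (m : lipfree M) : R := `|lipfree_val m|.

Lemma lipfree_normD M (m n : lipfree M) :
  lipfree_norm (m + n) <= lipfree_norm m + lipfree_norm n.
Proof. exact: ler_normD. Qed.

Lemma lipfree_normZ M (l : R) (m : lipfree M) :
  lipfree_norm (l *: m) = `|l| * lipfree_norm m.
Proof. exact: normrZ. Qed.

Lemma lipfree_norm_eq0 M (m : lipfree M) : lipfree_norm m = 0 -> m = 0.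
Proof. by move/normr0_eq0 => m0; exact: val_inj. Qed.

HB.instance Definition _ M := Lmodule_isNormed.Build R (lipfree M)
  (@lipfree_normD M) (@lipfree_normZ M) (@lipfree_norm_eq0 M).

Lemma lipfree_normE M (m : lipfree M) : `|m| = `|lipfree_val m|.
Proof. by []. Qed.

Lemma lipfree_delta_subproof M (x : M) : lip_delta x \in @lipfree_pred M.
Proof. by apply/asboolP/closed_span_sub; exists x. Qed.

Definition lipfree_delta M (x : M) : lipfree M :=
  Lipfree (lipfree_delta_subproof x).

Section maps.
Variables (M N : pMetricType R) (f : lip0 M N).

Lemma comp_op_linear : linear (fun g : lip0 N R^o => lip0_comp g f).
Proof. by move=> a g h; apply: lip0_ext. Qed.

Lemma comp_op_bounded :
  exists k, 0 <= k /\ forall g : lip0 N R^o, `|lip0_comp g f| <= k * `|g|.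
Proof.
have [[k [k0 kP]] _] := lip0P f; exists k; split => // g.
apply: best_const_lb => [|[x y]] /=; first by rewrite mulr_ge0// normr_ge0.
rewrite mdist_real (le_trans (lip_normP g _ _))//.
rewrite (mulrC k) -mulrA ler_wpM2l ?kP//.
exact: best_const_ge0.
Qed.

Definition comp_op : bounded_op (lip0 N R^o) (lip0 M R^o) :=
  mk_bop comp_op_linear comp_op_bounded.

(* The operator F(M) -> F(N) induced by f is the restriction to F(M) of the
   adjoint Lip_0(M)^* -> Lip_0(N)^* of g |-> g \o f; [lipfree_map_delta] and
   [lipfree_map_unique] show that it is the unique bounded operator sending
   delta(x) to delta(f x). *)
Lemma adjoint_comp_op_lipfree (m : lipfree M) :
  adjoint comp_op m \in @lipfree_pred N.
Proof.
case: m => m /= /asboolP mF; apply/asboolP; move: m mF.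
pose F := closed_span (range (@lip_delta N)).
apply: (@closed_span_ind _ _ _ (adjoint comp_op @^-1` F)).
- apply: preimage_closed; last exact: closed_closure.
  by move=> m _; exact: bop_continuous.
- have E : adjoint comp_op 0 = 0 by exact: linear0.
  by change (F (adjoint comp_op 0)); rewrite E; exact: closed_span0.
- move=> a u v [x _ <-] vF.
  have E : adjoint comp_op (a *: lip_delta x + v) =
      a *: adjoint comp_op (lip_delta x) + adjoint comp_op v.
    exact: linearP.
  change (F (adjoint comp_op (a *: lip_delta x + v))); rewrite E; apply: closed_spanP => //.
  by apply: closed_span_sub; exists (f x) => //; exact: bop_ext.
Qed.

Definition lipfree_map_val (m : lipfree M) : lipfree N :=
  Lipfree (adjoint_comp_op_lipfree m).

Lemma lipfree_map_linear : linear lipfree_map_val.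
Proof.
by move=> a m n; apply: val_inj; exact: (linearP (adjoint comp_op)).
Qed.

Lemma lipfree_map_bounded :
  exists k, 0 <= k /\ forall m, `|lipfree_map_val m| <= k * `|m|.
Proof.
exists (op_norm (adjoint comp_op)); split; first exact: op_norm_ge0.
by move=> m; exact: op_normP.
Qed.

Definition lipfree_map : bounded_op (lipfree M) (lipfree N) :=
  mk_bop lipfree_map_linear lipfree_map_bounded.

Lemma lipfree_map_delta x : lipfree_map (lipfree_delta x) = lipfree_delta (f x).
Proof. by apply: val_inj; exact: bop_ext. Qed.

Lemma lipfree_map_unique (T : bounded_op (lipfree M) (lipfree N)) :
  (forall x, T (lipfree_delta x) = lipfree_delta (f x)) -> T = lipfree_map.
Proof.
move=> Tf; apply: bop_ext => m; apply/eqP; rewrite -subr_eq0; apply/eqP.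
pose S : bounded_op (lipfree M) (lipfree N) := T - lipfree_map.
rewrite -[LHS]/(S m).
have Sdelta x : S (lipfree_delta x) = 0.
  by rewrite -[LHS]/(T _ - lipfree_map _) Tf lipfree_map_delta subrr.
have Sspan v : lin_span (range (@lip_delta M)) v ->
    exists2 n : lipfree M, lipfree_val n = v & S n = 0.
  move=> [s [sA ->]]; elim: s sA => [|p s IHs] sA.
    by exists 0; rewrite ?big_nil ?linear0.
  have [q qs|n nE Sn] := IHs; first by apply: sA; rewrite in_cons qs orbT.
  have [x _ xE] := sA p (mem_head _ _).
  exists (p.1 *: lipfree_delta x + n); last first.
    by rewrite (bop_linear S) Sdelta Sn scaler0 addr0.
  by rewrite big_cons -nE -xE.
apply/eqP; rewrite -normr_le0; apply/ler_addgt0Pr => e e0; rewrite add0r.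
case: m => m mF; have := mF; rewrite unfold_in => /asboolP/closureP_norm cl.
have k1 : 0 < op_norm S + 1 by rewrite ltr_wpDl// op_norm_ge0.
have [v /Sspan[n <- Sn]] := cl _ (divr_gt0 e0 k1).
rewrite ltr_pdivlMr// => /ltW; apply: le_trans.
rewrite -[S _]subr0 -Sn -linearB (le_trans (op_normP _ _))//.
by rewrite mulrC ler_wpM2l// lerDl.
Qed.

End maps.

End lipfree.

Definition bilipschitz {R : realType} {M N : pMetricType R} (f : M -> N) :=
  exists a b, [/\ 0 < a, 0 < b & forall x y,
    a * mdist x y <= mdist (f x) (f y) <= b * mdist x y].

(* Main.v *)
Require Import Defs.
From mathcomp Require Import all_boot all_order all_algebra.
From mathcomp Require Import all_classical all_reals all_analysis.
From mathcomp Require Import ring lra.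
Import Order.TTheory GRing.Theory Num.Theory.
Import numFieldNormedType.Exports.

(* Write T = \hat f, whose adjoint is C_f once F(M)^* is identified with
   Lip_0(M).  If f is bi-Lipschitz, McShane's extension theorem makes C_f onto,
   so T is bounded below, and a Hahn-Banach separation from its closed range
   makes it tauberian; conversely, by the open mapping theorem, an injective T
   with closed range is bounded below, and f inherits this since
   |delta(x) - delta(y)| = d(x, y).

   The heart of the matter is (ii) => (iv).  If f is not bi-Lipschitz, there are
   pairs (x_n, y_n) such that d(f x_n, f y_n) / d(x_n, y_n) tends to 0, and any
   weak-* limit z in F(M)^** of the molecules
   (delta(x_n) - delta(y_n)) / d(x_n, y_n) is killed by T^**.  As f is injective
   and M is complete, the pairs can be chosen sparse enough that there are
   1-Lipschitz functions g_k, tending to 0 pointwise, on which z is at least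
   some c > 0.  Elements of F(M) tend to 0 along (g_k), so z is not in F(M). *)

Set Implicit Arguments.
Unset Strict Implicit.
Unset Printing Implicit Defensive.

Local Open Scope classical_set_scope.
Local Open Scope ring_scope.

(** * Hahn-Banach separation *)

Section hahn_banach.
Context {R : realType} {V : normedModType R}.
Implicit Types p q : V -> R.

Definition sublinear q :=
  (forall x y, q (x + y) <= q x + q y) /\
  (forall t x, 0 <= t -> q (t *: x) <= t * q x).

Lemma sublinear0 q : sublinear q -> q 0 = 0.
Proof.
move=> [qD qZ]; apply/eqP; rewrite eq_le.
have := qZ 0 0 (lexx _); rewrite scale0r mul0r => -> /=.
by have := qD 0 0; rewrite addr0 -lerBlDr subrr.
Qed.

Lemma sublinearN q x : sublinear q -> - q (- x) <= q x.
Proof.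
move=> sq; have := sq.1 x (- x); rewrite subrr sublinear0//.
by rewrite addrC -lerBlDl add0r.
Qed.

Lemma le_inf_add (A B : set R) (c : R) : A !=set0 -> B !=set0 ->
  (forall a b, A a -> B b -> c <= a + b) -> c <= inf A + inf B.
Proof.
move=> A0 B0 cAB; rewrite -lerBlDr; apply: lb_le_inf => // a Aa.
rewrite lerBlDr -lerBlDl; apply: lb_le_inf => // b Bb.
by rewrite lerBlDl cAB.
Qed.

Lemma le_mul_inf (A : set R) (c t : R) : A !=set0 -> 0 <= t ->
  c <= 0 \/ 0 < t -> (forall a, A a -> c <= t * a) -> c <= t * inf A.
Proof.
move=> A0; rewrite le_eqVlt => /orP[/eqP <- [c0 _|]|t0 _ cA].
- by rewrite mul0r.
- by rewrite ltxx.
rewrite mulrC -ler_pdivrMr//; apply: lb_le_inf => // a Aa.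
by rewrite ler_pdivrMr// mulrC cA.
Qed.

(* The largest sublinear minorant of [q] whose value at [- v] is at most
   [- q v]. *)
Definition tilt q v x := inf [set q (x + t *: v) - t * q v | t in [set t | 0 <= t]].

Lemma tilt_le q v x t : sublinear q -> 0 <= t ->
  tilt q v x <= q (x + t *: v) - t * q v.
Proof.
move=> sq t0; apply: ge_inf; last by exists t.
(* [- q (- x)] is a lower bound, since [s * q v = q (s *: v) <= q (x + s *: v) + q (- x)]. *)
exists (- q (- x)) => _ [s s0 <-]; rewrite lerBrDr addrC lerBlDr.
rewrite (@le_trans _ _ (q (s *: v)))//; last first.
  by rewrite -[in leLHS](addKr x (s *: v)) addrC sq.1.
have [->|s_neq0] := eqVneq s 0.
  by rewrite scale0r mul0r sublinear0.
rewrite mulrC -ler_pdivlMr ?lt_neqAle ?s0 1?eq_sym ?s_neq0//.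
rewrite -[in leLHS](scalerK s_neq0 v) mulrC.
by apply: sq.2; rewrite invr_ge0.
Qed.

Lemma tilt_set_neq0 q v x :
  [set q (x + t *: v) - t * q v | t in [set t | 0 <= t]] !=set0.
Proof. by exists (q (x + 0 *: v) - 0 * q v); exists 0 => /=. Qed.

Lemma sublinear_tilt q v : sublinear q -> sublinear (tilt q v).
Proof.
move=> sq; split=> [x y|t x t0].
  apply: le_inf_add; [exact: tilt_set_neq0..|].
  move=> _ _ [s s0 <-] [t t0 <-].
  apply: le_trans (@tilt_le q v _ (s + t) sq (addr_ge0 s0 t0)) _.
  rewrite scalerDl mulrDl opprD addrACA [leRHS]addrACA lerD2r.
  exact: sq.1.
apply: le_mul_inf => //; first exact: tilt_set_neq0.
  move: t0; rewrite le_eqVlt => /orP[/eqP <-|]; last by right.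
  left; rewrite scale0r (le_trans (@tilt_le q v 0 0 sq _))//.
  by rewrite scale0r addr0 mul0r subr0 sublinear0.
move=> _ [s s0 <-]; apply: le_trans (@tilt_le q v _ (t * s) sq (mulr_ge0 t0 s0)) _.
by rewrite -scalerA -scalerDr mulrBr mulrA lerD2r sq.2.
Qed.

Lemma tilt_leq q v x : sublinear q -> tilt q v x <= q x.
Proof.
by move=> sq; have := @tilt_le q v x 0 sq (lexx _); rewrite scale0r addr0 mul0r subr0.
Qed.

Lemma tiltN q v : sublinear q -> tilt q v (- v) <= - q v.
Proof.
move=> sq; have := @tilt_le q v (- v) 1 sq ler01.
by rewrite scale1r addNr mul1r sublinear0// sub0r.
Qed.

(** Zorn's lemma on the sublinear minorants of [p], where going up means getting smaller. A nonempty
    chain is bounded by its pointwise infimum, which is finite because each minorant is at least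
    [- p (- x)] at [x]. *)
Lemma minimal_sublinear p : sublinear p -> exists2 q, sublinear q &
  (forall x, q x <= p x) /\
  forall r, sublinear r -> (forall x, r x <= q x) -> r = q.
Proof.
move=> sp; pose T := {q : V -> R | sublinear q /\ forall x, q x <= p x}.
pose le (a b : T) := `[< forall x, sval b x <= sval a x >].
have [||||[q [sq qp]] qmin] := @Zorn T le.
- by move=> t; apply/asboolP.
- by move=> r s t /asboolP rs /asboolP st; apply/asboolP => x; exact: le_trans (rs x).
- move=> [s sP] [t tP] /asboolP/= st /asboolP/= ts; apply: eq_exist.
  by apply/funext => x; apply/eqP; rewrite eq_le st ts.
- move=> A Atot; have [->|/set0P[a0 Aa0]] := eqVneq A set0.
    by exists (exist _ p (conj sp (fun x => lexx _))).
  pose S x := [set sval a x | a in A].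
  have S0 x : S x !=set0 by exists (sval a0 x), a0.
  pose q x := inf (S x).
  have qle a x : A a -> q x <= sval a x.
    move=> Aa; apply: ge_inf; last by exists a.
    exists (- p (- x)) => _ [[b [sb bp]] _ <-] /=.
    by rewrite (le_trans _ (sublinearN x sb))// lerN2.
  have sq : sublinear q.
    split=> [x y|t x t0].
      apply: le_inf_add => // _ _ [a Aa <-] [b Ab <-].
      (* Of two comparable members, the smaller one is used at both points. *)
      have [/asboolP ab|/asboolP ba] := Atot _ _ Aa Ab.
        rewrite (le_trans (qle _ _ Ab))// (le_trans ((svalP b).1.1 _ _))//.
        by rewrite lerD2r.
      rewrite (le_trans (qle _ _ Aa))// (le_trans ((svalP a).1.1 _ _))//.
      by rewrite lerD2l.
    apply: le_mul_inf => //.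
      move: t0; rewrite le_eqVlt => /orP[/eqP <-|]; last by right.
      by left; rewrite scale0r (le_trans (qle _ _ Aa0))// (sublinear0 (svalP a0).1).
    move=> _ [a Aa <-]; rewrite (le_trans (qle _ _ Aa))//.
    exact: (svalP a).1.2.
  have qp x : q x <= p x.
    by rewrite (le_trans (qle _ _ Aa0))//; exact: (svalP a0).2.
  by exists (exist _ q (conj sq qp)) => a Aa; apply/asboolP => x; exact: qle.
exists q => //; split=> // r sr rq.
have rp x : r x <= p x by exact: le_trans (rq x) (qp x).
by have /(congr1 sval) := qmin (exist _ r (conj sr rp)) (asboolT rq).
Qed.

(** Minimality gives [tilt q v = q]; the tilt at parameter 1 then yields [q x <= q (x + v) - q v],
    the reverse of subadditivity. *)
Lemma minimal_sublinear_additive q : sublinear q ->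
  (forall r, sublinear r -> (forall x, r x <= q x) -> r = q) ->
  forall a u v, q (a *: u + v) = a * q u + q v.
Proof.
move=> sq qmin.
have qD x v : q (x + v) = q x + q v.
  apply/eqP; rewrite eq_le sq.1/= -lerBrDr.
  rewrite -[in leLHS](qmin _ (sublinear_tilt v sq) (fun x => tilt_leq v x sq)).
  by have := tilt_le v x sq ler01; rewrite scale1r mul1r.
have qN x : q (- x) = - q x.
  by apply/eqP; rewrite -addr_eq0 -qD addNr sublinear0.
have qZ t x : 0 <= t -> q (t *: x) = t * q x.
  move=> t0; apply/eqP; rewrite eq_le sq.2//=.
  by rewrite -lerN2 -qN -scalerN (le_trans (sq.2 _ _ t0))// qN mulrN.
move=> a u v; rewrite qD; congr (_ + _).
have [/qZ//|a0] := leP 0 a.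
by rewrite -[a]opprK scaleNr qN qZ ?oppr_ge0 ?ltW// !mulNr.
Qed.

(** [phi] is a minimal sublinear functional below the tilt at [v] of [p], the distance to [Z]. It is
    linear and dominated by [p], so it vanishes on [Z], and [phi (- v) <= - p v < 0]. *)
Lemma hahn_banach_separation (Z : set V) (v : V) : closed Z -> Z 0 ->
  (forall a u w, Z u -> Z w -> Z (a *: u + w)) -> ~ Z v ->
  exists phi : dual V, (forall u, Z u -> phi u = 0) /\ phi v <> 0.
Proof.
move=> cZ Z0 Zlin nZv.
pose S x := [set `|x - w| | w in Z].
have S0 x : S x !=set0 by exists `|x - 0|, 0.
pose p x := inf (S x).
have ple x w : Z w -> p x <= `|x - w|.
  by move=> Zw; apply: ge_inf; [exists 0 => _ [? _ <-] | exists w].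
have p_ge0 x : 0 <= p x by apply: lb_le_inf => // _ [? _ <-].
have sp : sublinear p.
  split=> [x y|t x t0].
    apply: le_inf_add => // _ _ [u Zu <-] [w Zw <-].
    apply: le_trans (ple _ (1 *: u + w) _) _; first exact: Zlin.
    by rewrite scale1r opprD addrACA ler_normD.
  apply: le_mul_inf => //.
    move: t0; rewrite le_eqVlt => /orP[/eqP <-|]; last by right.
    by left; rewrite scale0r (le_trans (ple _ _ Z0))// subrr normr0.
  move=> _ [u Zu <-]; apply: le_trans (ple _ (t *: u + 0) _) _.
    exact: Zlin.
  by rewrite addr0 -scalerBr normrZ ger0_norm.
have pv : 0 < p v.
  rewrite lt_neqAle p_ge0 andbT; apply/negP => /eqP pv; apply: nZv.
  rewrite (iffLR (closure_id _) cZ); apply/closureP_norm => e e0.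
  by have [|_ [w Zw <-]] := inf_lt (S0 v) (x := e); [rewrite -/(p v) -pv | exists w].
have [q sq [qle qmin]] := minimal_sublinear (sublinear_tilt v sp).
have qlin := minimal_sublinear_additive sq qmin.
have qp x : q x <= p x by apply: le_trans (qle x) (tilt_leq v x sp).
have q0 := sublinear0 sq.
have qN x : q (- x) = - q x.
  by have := qlin (-1) x 0; rewrite !addr0 scaleN1r q0 addr0 mulN1r.
have linq : linear (q : V -> R^o) by move=> a u w; exact: qlin.
have bq : exists k, 0 <= k /\ forall x, `|(q : V -> R^o) x| <= k * `|x|.
  exists 1; split=> // x; rewrite mul1r ler_norml -lerN2 opprK -qN.
  rewrite -[X in q (- x) <= X]normrN.
  by rewrite -[X in q (- x) <= `|X|]subr0 -[X in q x <= `|X|]subr0 !(le_trans (qp _)) ?ple.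
exists (mk_bop linq bq); split=> [u Zu|/= /eqP qv].
  apply/eqP; rewrite eq_le; apply/andP; split.
    by rewrite -(normr0 V) -(subrr u) (le_trans (qp _)) ?ple.
  rewrite -oppr_le0 -qN -(normr0 V) -(subrr (- u)) (le_trans (qp _))// ple//.
  by rewrite -[- u]addr0 -scaleN1r; exact: Zlin.
have := le_trans (qle (- v)) (tiltN v sp).
by rewrite qN lerN2 (eqP qv) leNgt pv.
Qed.

End hahn_banach.

(** * Completeness along geometric sequences and the open mapping theorem *)

Section geometric_completeness.
Context {R : realType}.

(** Completeness for sequences with geometrically small increments, with the rate built in; it
    passes to closed subspaces by norm estimates alone. *)
Definition geometrically_complete (V : normedModType R) :=
  forall (s : nat -> V) (K q : R), 0 <= q < 1 ->
    (forall k, `|s k.+1 - s k| <= K * q ^+ k) ->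
    exists l, forall k, `|l - s k| <= K * q ^+ k / (1 - q).

(** The bound is the sum of [K * q ^+ k] over [m <= k < n], written as a difference of two tails. *)
Lemma geometric_tail_le (a : nat -> R) (K q : R) (m n : nat) : 0 <= q < 1 ->
  (forall k, `|a k.+1 - a k| <= K * q ^+ k) -> (m <= n)%N ->
  `|a n - a m| <= K * q ^+ m / (1 - q) - K * q ^+ n / (1 - q).
Proof.
move=> /andP[q0 q1] aK /subnKC <-; elim: (n - m)%N => [|j IH].
  by rewrite addn0 !subrr normr0.
rewrite addnS -(subrKA (a (m + j)%N)) (le_trans (ler_normD _ _))//.
have qN0 : 1 - q != 0 by rewrite subr_eq0 gt_eqF.
rewrite (le_trans (lerD (aK _) IH))// exprS.
rewrite [X in _ <= _ - X](_ : _ = K * q ^+ (m + j) / (1 - q) - K * q ^+ (m + j)).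
  lra.
by field.
Qed.

(** The intervals [[a k - t k, a k + t k]], with [t k] the geometric tail, meet pairwise; the
    supremum of their left ends lies in all of them. *)
Lemma geometric_cvg_real (a : nat -> R) (K q : R) : 0 <= q < 1 ->
  (forall k, `|a k.+1 - a k| <= K * q ^+ k) ->
  exists l, forall k, `|l - a k| <= K * q ^+ k / (1 - q).
Proof.
move=> q01 aK; have /andP[q0 q1] := q01.
pose t k := K * q ^+ k / (1 - q).
have t0 k : 0 <= t k.
  rewrite divr_ge0 ?subr_ge0 ?(ltW q1)//.
  exact: le_trans (normr_ge0 _) (aK k).
have tail m n : (m <= n)%N -> `|a n - a m| <= t m - t n.
  exact: geometric_tail_le.
have ub m k : a m - t m <= a k + t k.
  have t0m := t0 m; have t0k := t0 k.
  have [/tail|/ltnW/tail] := leqP m k; rewrite ler_norml => /andP[]; lra.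
pose S := range (fun k => a k - t k).
have hS k : ubound S (a k + t k) by move=> _ [m _ <-].
exists (sup S) => k; rewrite -/(t k) ler_norml; apply/andP; split.
  rewrite lerBrDl; apply: ub_le_sup; last by exists k.
  by exists (a k + t k).
by rewrite lerBlDl; apply: ge_sup => //; exists (a k - t k), k.
Qed.

Lemma ler_forall_geometric (x y K q : R) : 0 <= q < 1 ->
  (forall k, x <= y + K * q ^+ k) -> x <= y.
Proof.
move=> /andP[q0 q1] xy.
have cv : (fun k => y + K * q ^+ k) @ \oo --> y + K * 0.
  by apply: cvgD; [exact: cvg_cst | apply: cvgMr; apply: cvg_expr; rewrite ger0_norm].
rewrite mulr0 addr0 in cv.
by apply: (cvgr_to_ge cv); near=> k; exact: xy.
Unshelve. all: by end_near. Qed.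

Lemma geometric_norm_eq0 (V : normedModType R) (v : V) (K q : R) :
  0 <= q < 1 -> (forall k, `|v| <= K * q ^+ k) -> v = 0.
Proof.
move=> q01 vK; apply/eqP; rewrite -normr_le0; apply: ler_forall_geometric q01 _.
by move=> k; rewrite add0r.
Qed.

(** The limit is taken pointwise; its defect of linearity at given vectors is dominated by a
    geometric sequence, hence zero. *)
Lemma geometrically_complete_dual (V : normedModType R) :
  geometrically_complete (dual V).
Proof.
move=> s K q q01 sK; have /andP[q0 q1] := q01.
have K0 : 0 <= K by have := sK 0%N; rewrite expr0 mulr1; exact: le_trans (normr_ge0 _).
have sv v k : `|s k.+1 v - s k v| <= K * `|v| * q ^+ k.
  rewrite mulrAC; apply: le_trans (op_normP (s k.+1 - s k) v) _.
  exact: (ler_wpM2r (normr_ge0 v) (sK k)).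
have /choice[l lP] : forall v, exists l, forall k,
    `|l - s k v| <= K * `|v| * q ^+ k / (1 - q).
  by move=> v; exact: (geometric_cvg_real (a := fun k => s k v)).
have linl : linear (l : V -> R^o).
  move=> a u v; apply/eqP; rewrite -subr_eq0; apply/eqP.
  pose C := (K * `|a *: u + v| + `|a| * (K * `|u|) + K * `|v|) / (1 - q).
  apply: (@geometric_norm_eq0 R^o _ C q q01) => k.
  have -> : l (a *: u + v) - (a *: l u + l v : R^o) =
      (l (a *: u + v) - s k (a *: u + v)) - a * (l u - s k u) - (l v - s k v).
    by rewrite (bop_linear (s k)) /GRing.scale/=; ring.
  have h1 := lP (a *: u + v) k; have h2 := lP u k; have h3 := lP v k.
  rewrite (le_trans (ler_normB _ _))//.
  rewrite (le_trans (lerD (ler_normB _ _) h3))//.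
  rewrite normrM.
  rewrite (le_trans (lerD (lerD h1 (ler_wpM2l (normr_ge0 a) h2)) (lexx _)))//.
  suff -> : C * q ^+ k = K * `|a *: u + v| * q ^+ k / (1 - q) +
      `|a| * (K * `|u| * q ^+ k / (1 - q)) + K * `|v| * q ^+ k / (1 - q) by [].
  by rewrite /C; field; rewrite subr_eq0 gt_eqF.
have bl : exists k, 0 <= k /\ forall v, `|(l : V -> R^o) v| <= k * `|v|.
  exists (K / (1 - q) + `|s 0%N|); split.
    by rewrite addr_ge0// divr_ge0// subr_ge0 ltW.
  move=> v; rewrite -[l v](subrK (s 0%N v)) (le_trans (ler_normD _ _))// mulrDl.
  apply: lerD; last exact: op_normP.
  by have := lP v 0%N; rewrite expr0 mulr1 mulrAC.
exists (mk_bop linl bl) => k; apply: best_const_lb.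
  by rewrite divr_ge0 ?subr_ge0 ?(ltW q1)// mulr_ge0// exprn_ge0.
move=> v; apply: le_trans (lP v k) _.
by rewrite [leRHS]mulrAC [K * _ * `|v|]mulrAC.
Qed.

Section closed_range.
Context {X W : normedModType R} (T : bounded_op X W).

(* Otherwise there are vectors [v_k] with [T v_k] of norm 1 that are not
   approximated by images of vectors of norm at most [C_k], and with [C_k]
   growing fast enough a preimage of [\sum_k 4^-k *: T v_k] contradicts this. *)
Lemma closed_range_approx : geometrically_complete W -> closed (range T) ->
  exists2 C, 0 <= C & forall v, exists u,
    `|u| <= C * `|T v| /\ `|T v - T u| <= `|T v| / 2.
Proof.
move=> cW cT; apply: contrapT => noC.
(* A vector refuting [C] has [T v != 0], as [u = 0] would do otherwise, so it can be scaled to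
   [|T v| = 1]. For negative [C] the choice is a dummy. *)
have /choice[pick pickP] : forall C, exists v, 0 <= C ->
    `|T v| = 1 /\ forall u, `|u| <= C -> 1 / 2 < `|T v - T u|.
  move=> C; have [C0|C0] := leP 0 C; last by exists 0.
  apply: contrapT => noV; apply: noC; exists C => // v.
  have [Tv0|Tv0] := eqVneq `|T v| 0.
    exists 0; rewrite Tv0 normr0 mulr0 mul0r lexx; split=> //.
    by rewrite linear0 subr0 Tv0.
  apply: contrapT => nou; apply: noV; exists (`|T v|^-1 *: v) => _.
  rewrite linearZ normrZ normfV normr_id mulVf//; split=> // u uC.
  rewrite ltNge; apply/negP => uv; apply: nou; exists (`|T v| *: u).
  rewrite normrZ normr_id mulrC ler_wpM2r//; split=> //.
  rewrite linearZ -[X in X - _](scalerKV Tv0) -scalerBr normrZ normr_id.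
  by rewrite ler_wpM2l//; move: uv; rewrite div1r.
have [q qE] : exists q : R, q = 4^-1 by exists 4^-1.
have q01 : 0 <= q < 1 by rewrite qE; lra.
(* Chosen so that [4 ^+ k *: (w - u)] has norm at most [c k u] as soon as [|w| <= k]. *)
pose c k (u : X) : R := 4 ^+ k * (k%:R + `|u|).
pose U := fix U k : X :=
  if k is j.+1 then U j + q ^+ j *: pick (c j (U j)) else 0.
have c0 k : 0 <= c k (U k) by rewrite mulr_ge0// addr_ge0.
have TU j : T (U j.+1) - T (U j) = q ^+ j *: T (pick (c j (U j))).
  by rewrite /= linearD addrAC subrr add0r linearZ.
have [] := cW (T \o U) 1 q q01.
  move=> k; rewrite TU normrZ.
  by rewrite (pickP _ (c0 k)).1 mulr1 mul1r ger0_norm// exprn_ge0// qE; lra.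
move=> l lP.
have [w _ wl] : range T l.
  rewrite (iffLR (closure_id _) cT); apply/closureP_norm => e e0.
  apply: contrapT => /forall2NP noe.
  have : e <= 0.
    apply: (@ler_forall_geometric _ _ (1 / (1 - q)) q q01) => k.
    rewrite add0r; have [/(_ (imageT _ _))//|] := noe (T (U k)).
    move/negP; rewrite -leNgt => /le_trans; apply.
    by apply: le_trans (lP k) _; rewrite mulrAC.
  by rewrite leNgt e0.
(* At this stage [4 ^+ k *: (w - U k)] is an admissible competitor, and its image is within
   [q / (1 - q) = 1/3 < 1/2] of the image of the chosen vector. *)
pose k := (Num.truncn `|w|).+1.
have wk : `|w| <= k%:R by rewrite ltW// truncnS_gt.
have q4 : 4 ^+ k * q ^+ k = 1 by rewrite -exprMn qE mulfV ?expr1n.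
have := (pickP _ (c0 k)).2 (4 ^+ k *: (w - U k)).
rewrite normrZ ger0_norm ?exprn_ge0// ler_wpM2l ?exprn_ge0//; last first.
  by rewrite (le_trans (ler_normB _ _))// lerD2r.
move=> /(_ isT); rewrite ltNge => /negP; apply.
have -> : T (pick (c k (U k))) = 4 ^+ k *: (T (U k.+1) - T (U k)).
  by rewrite TU scalerA q4 scale1r.
have -> : T (4 ^+ k *: (w - U k)) = 4 ^+ k *: (l - T (U k)).
  by rewrite linearZ linearB /= wl.
rewrite -scalerBr opprB addrA subrK normrZ distrC.
rewrite ger0_norm ?exprn_ge0// (le_trans (ler_wpM2l _ (lP k.+1))) ?exprn_ge0//.
rewrite (_ : 4 ^+ k * _ = 4 ^+ k * q ^+ k * (q / (1 - q))); last by rewrite exprS; ring.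
by rewrite q4 mul1r ler_pdivrMr qE; lra.
Qed.

(** Subtracting approximate preimages halves the bound on [T (r k)] at each step. The part
    subtracted so far converges to some [l] with [T l = T v] and [|l| <= 2 * C * |T v|]; injectivity
    gives [l = v]. *)
Lemma closed_range_bounded_below :
  geometrically_complete X -> geometrically_complete W ->
  injective T -> closed (range T) ->
  exists2 C, 0 < C & forall v, `|v| <= C * `|T v|.
Proof.
move=> cX cW injT /(closed_range_approx cW)[C C0 /choice[a aP]].
exists (2 * C + 1) => [|v]; first lra.
have q01 : 0 <= (2^-1 : R) < 1 by lra.
pose r k := iter k (fun u => u - a u) v.
have Tr k : `|T (r k)| <= `|T v| * 2^-1 ^+ k.
  elim: k => [|k IH]; first by rewrite mulr1.
  rewrite /r iterS -/(r k) linearB (le_trans (aP _).2)// exprSr mulrA.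
  by rewrite ler_wpM2r.
have [|l lP] := cX (fun k => v - r k) (C * `|T v|) _ q01.
  move=> k; rewrite /r iterS -/(r k) !opprB addrC addrA subrK addrC subrK.
  by rewrite (le_trans (aP _).1)// -mulrA ler_wpM2l.
have inv2 : (1 - 2^-1 : R)^-1 = 2 by rewrite (_ : 1 - 2^-1 = 2^-1) ?invrK//; lra.
rewrite inv2 in lP.
have lv : l = v.
  apply: injT; apply/eqP; rewrite -subr_eq0; apply/eqP.
  apply: (@geometric_norm_eq0 _ _ (op_norm T * (C * `|T v| * 2) + `|T v|) _ q01).
  move=> k; have -> : T l - T v = T (l - (v - r k)) - T (r k).
    by rewrite -!linearB opprB addrA addrAC addrK.
  rewrite (le_trans (ler_normB _ _))// mulrDl lerD ?Tr//.
  rewrite (le_trans (op_normP T _))// -mulrA ler_wpM2l ?op_norm_ge0//.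
  rewrite (le_trans (lP k))//.
  have : 0 <= C * `|T v| * 2^-1 ^+ k by rewrite !mulr_ge0// exprn_ge0.
  lra.
have := lP 0%N; rewrite lv subrr subr0 expr0 mulr1 => /le_trans; apply.
have : 0 <= `|T v| by [].
lra.
Qed.

End closed_range.

End geometric_completeness.

(** * Lipschitz-free spaces *)

Section lipschitz_free.
Context {R : realType}.
Implicit Types M N : pMetricType R.

(** Inherited from the dual of Lip_0(M), in which F(M) is closed. *)
Lemma geometrically_complete_lipfree M : geometrically_complete (lipfree M).
Proof.
move=> s K q q01 sK.
have [l lP] := @geometrically_complete_dual R (lip0 M R^o) (@lipfree_val _ M \o s) K q q01 sK.
suff lF : l \in @lipfree_pred R M by exists (Lipfree lF).
apply/asboolP; rewrite /closed_span.
rewrite (iffLR (closure_id (closure _)) (@closed_closure _ _)).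
apply/closureP_norm => e e0; apply: contrapT => /forall2NP noe.
suff : e <= 0 by rewrite leNgt e0.
apply: (@ler_forall_geometric _ _ _ (K / (1 - q)) q q01) => k.
rewrite add0r; have [|] := noe (lipfree_val (s k)).
  by have /asboolP := valP (s k).
by move/negP; rewrite -leNgt => /le_trans; apply; rewrite mulrAC; exact: lP.
Qed.

Lemma lipfree_approx M (m : lipfree M) e : 0 < e ->
  exists s : seq (R * M),
    `|m - \sum_(p <- s) p.1 *: lipfree_delta p.2| < e.
Proof.
case: m => m mF e0; have := mF; rewrite unfold_in => /asboolP/closureP_norm.
move=> /(_ e e0)[_ [s [sA ->]] me].
suff [t tE] : exists t : seq (R * M), lipfree_val (\sum_(p <- t)
    p.1 *: lipfree_delta p.2) = \sum_(p <- s) p.1 *: p.2.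
  by exists t; move: me; rewrite -tE.
elim: s sA {me} => [|p s IH] sA; first by exists [::]; rewrite !big_nil.
have [|t tE] := IH; first by move=> q qs; apply: sA; rewrite in_cons qs orbT.
have [x _ xE] := sA p (mem_head _ _).
by exists ((p.1, x) :: t); rewrite !big_cons -tE -xE.
Qed.

Lemma bop_lipfree_eq0 M (W : normedModType R) (S : bounded_op (lipfree M) W) :
  (forall x, S (lipfree_delta x) = 0) -> forall m, S m = 0.
Proof.
move=> S0 m; apply/eqP; rewrite -normr_le0; apply/ler_addgt0Pr => e e0.
have k1 : 0 < op_norm S + 1 by rewrite ltr_wpDl// op_norm_ge0.
have [s] := lipfree_approx m (divr_gt0 e0 k1).
rewrite ltr_pdivlMr// => /ltW; rewrite add0r; apply: le_trans.
have -> : S m = S (m - \sum_(p <- s) p.1 *: lipfree_delta p.2).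
  rewrite linearB linear_sum big1 ?subr0// => p _.
  by rewrite linearZ /= S0 scaler0.
by rewrite (le_trans (op_normP _ _))// mulrC ler_wpM2l// lerDl.
Qed.

Lemma lipfree_norm_delta_le M (x y : M) :
  `|lipfree_delta x - lipfree_delta y| <= mdist x y.
Proof.
apply: best_const_lb => [|g]; first exact: mdist_ge0.
by rewrite mulrC; exact: lip_normP.
Qed.

Lemma lipfree_le_norm M (m : lipfree M) (g : lip0 M R^o) k :
  (forall x y, `|g x - g y| <= k * mdist x y) -> 0 <= k ->
  `|lipfree_val m g| <= k * `|m|.
Proof.
move=> gk k0; apply: le_trans (op_normP (lipfree_val m) g) _.
rewrite mulrC ler_wpM2r ?op_norm_ge0//.
by apply: best_const_lb => // -[x y] /=; rewrite mdist_real.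
Qed.

Lemma is_lip0_dist M (y : M) :
  is_lip0 (fun x : M => mdist x y - mdist point y : R^o).
Proof.
split; last by rewrite subrr.
exists 1; split=> // u v; rewrite mdist_real mul1r opprB addrA subrK ler_norml.
have := metric_triangle u v y; have := metric_triangle v u y.
rewrite (metric_sym v u); lra.
Qed.

(** The lower bound comes from testing on the distance to [y], shifted to vanish at the base
    point. *)
Lemma lipfree_norm_delta M (x y : M) :
  `|lipfree_delta x - lipfree_delta y| = mdist x y.
Proof.
apply/eqP; rewrite eq_le lipfree_norm_delta_le/=.
pose g := mk_lip0 (is_lip0_dist y).
have g1 u v : `|g u - g v| <= 1 * mdist u v.
  rewrite mul1r -[leLHS]/(`|(mdist u y - _) - (mdist v y - _)|).
  rewrite opprB addrA subrK ler_norml.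
  have := metric_triangle u v y; have := metric_triangle v u y.
  rewrite (metric_sym v u); lra.
have := @lipfree_le_norm _ (lipfree_delta x - lipfree_delta y) g 1 g1 ler01.
rewrite mul1r; apply: le_trans.
rewrite -[X in `|X|]/((mdist x y - _) - (mdist y y - _)).
by rewrite opprB addrA subrK mdistxx subr0 ler_norm.
Qed.

Lemma lipfree_delta_point M : lipfree_delta (point : M) = 0.
Proof.
by apply: val_inj; apply: bop_ext => g; have [_] := lip0P g.
Qed.

Lemma lip_eval_linear M (g : lip0 M R^o) :
  linear (fun m : lipfree M => lipfree_val m g : R^o).
Proof. by []. Qed.

Lemma lip_eval_bounded M (g : lip0 M R^o) : exists k, 0 <= k /\
  forall m : lipfree M, `|lipfree_val m g : R^o| <= k * `|m|.
Proof.
exists `|g|; split=> // m; rewrite mulrC; exact: op_normP.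
Qed.

(** The canonical map from Lip_0(M) to F(M)^*; [dual_lipfree_eval] shows that it is onto. *)
Definition lip_eval M (g : lip0 M R^o) : dual (lipfree M) :=
  mk_bop (lip_eval_linear g) (lip_eval_bounded g).

Lemma lip_eval_norm M (g : lip0 M R^o) : `|lip_eval g| <= `|g|.
Proof. by apply: best_const_lb => // m; rewrite mulrC; exact: (op_normP (lipfree_val m)). Qed.

(** [g] is [phi] composed with delta; the two functionals agree because the deltas span a dense
    subspace. *)
Lemma dual_lipfree_eval M (phi : dual (lipfree M)) :
  exists g : lip0 M R^o, phi = lip_eval g.
Proof.
have gP : is_lip0 (fun x : M => phi (lipfree_delta x) : R^o).
  split; last by rewrite lipfree_delta_point linear0.
  exists (op_norm phi); split; first exact: op_norm_ge0.
  by move=> x y; rewrite mdist_real -lipfree_norm_delta -linearB op_normP.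
exists (mk_lip0 gP); apply: bop_ext => m; apply/eqP; rewrite -subr_eq0; apply/eqP.
apply: (@bop_lipfree_eq0 _ _ (phi - lip_eval (mk_lip0 gP))) => x.
by apply/eqP; rewrite subr_eq0.
Qed.

Section maps.
Context {M N : pMetricType R} (f : lip0 M N).

(** Under [lip_eval], the adjoint of \hat f becomes C_f. *)
Lemma adjoint_lip_eval h :
  adjoint (lipfree_map f) (lip_eval h) = lip_eval (comp_op f h).
Proof. exact: bop_ext. Qed.

(** McShane's formula [h p = inf_x (g x + L * d(p, f x))] extends the function [f x |-> g x] from
    f(M) to N with the same Lipschitz constant [L]. *)
Lemma mcshane_comp_op a (g : lip0 M R^o) : 0 < a ->
  (forall x y, a * mdist x y <= mdist (f x) (f y)) ->
  exists h, comp_op f h = g /\ `|h| <= a^-1 * `|g|.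
Proof.
move=> a0 fa; pose L := a^-1 * `|g|.
have L0 : 0 <= L by rewrite mulr_ge0// invr_ge0 ltW.
(* The function [f x |-> g x] is [L]-Lipschitz on f(M). *)
have gL x y : g y - L * mdist (f x) (f y) <= g x.
  have := lip_normP g y x; rewrite ler_norml => /andP[_]; rewrite lerBlDr => gyx.
  rewrite lerBlDl (le_trans gyx)// lerD2r -lip0_normE /L.
  rewrite [a^-1 * _]mulrC -mulrA ler_wpM2l// ler_pdivlMl//.
  by rewrite metric_sym.
pose S p := range (fun x => g x + L * mdist p (f x)).
have Slb p y : lbound (S p) (g y - L * mdist p (f y)).
  move=> _ [x _ <-]; rewrite lerBlDr -addrA -mulrDr -lerBlDr.
  apply: le_trans (gL x y); rewrite lerD2l lerN2 ler_wpM2l//.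
  by rewrite (metric_sym p (f x)) metric_triangle.
have Sinf p : has_lbound (S p) by exists (g point - L * mdist p (f point)).
have S0 p : S p !=set0 by exists (g point + L * mdist p (f point)), point.
pose h p := inf (S p).
have hf y : h (f y) = g y.
  apply/eqP; rewrite eq_le; apply/andP; split.
    by apply: ge_inf => //; exists y => //; rewrite mdistxx mulr0 addr0.
  apply: lb_le_inf => //; have := Slb (f y) y.
  by rewrite mdistxx mulr0 subr0.
have hL p q : h p - h q <= L * mdist p q.
  rewrite lerBlDr -lerBlDl; apply: lb_le_inf => // _ [x _ <-].
  rewrite lerBlDl (@le_trans _ _ (g x + L * mdist p (f x)))//.
    by apply: ge_inf => //; exists x.
  by rewrite addrCA lerD2l -mulrDr ler_wpM2l// metric_triangle.
have hL' p q : `|h p - h q| <= L * mdist p q.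
  by rewrite ler_norml lerNl opprB hL andbT metric_sym hL.
have hP : is_lip0 (h : N -> R^o).
  split; last by rewrite -(lip0P f).2 hf (lip0P g).2.
  by exists L; split=> // p q; rewrite mdist_real.
exists (mk_lip0 hP); split; first by apply: lip0_ext => y; exact: hf.
by apply: best_const_lb => // -[p q]; rewrite mdist_real; exact: hL'.
Qed.

End maps.

End lipschitz_free.

(** * Operators that are bounded below, and tauberian operators *)

Section bounded_below.
Context {R : realType} {X W : normedModType R} (T : bounded_op X W).

(** Preimages of approximants of [y] at rate [2^-k] have geometrically small increments, and their
    limit is a preimage of [y]. *)
Lemma bounded_below_closed_range C : geometrically_complete X -> 0 <= C ->
  (forall v, `|v| <= C * `|T v|) -> closed (range T).
Proof.
move=> cX C0 TC; apply/closure_id/seteqP; split; first exact: subset_closure.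
move=> y /closureP_norm yT.
have q01 : 0 <= (2^-1 : R) < 1 by lra.
have /choice[m mP] : forall k, exists m, `|y - T m| <= 2^-1 ^+ k.
  move=> k; have [|_ [m _ <-] ym] := yT (2^-1 ^+ k); last by exists m; exact: ltW.
  by rewrite exprn_gt0.
(* The factor 2 absorbs [2^-k + 2^-(k+1)], the distance between consecutive approximants. *)
have [|l lP] := cX m (C * 2) _ q01.
  move=> k; rewrite (le_trans (TC _))// -mulrA ler_wpM2l// linearB.
  rewrite (_ : _ - _ = (y - T (m k)) - (y - T (m k.+1))); last first.
    by rewrite opprB [RHS]addrC subrKA.
  rewrite (le_trans (ler_normB _ _))// (le_trans (lerD (mP _) (mP _)))//.
  have : 0 <= (2^-1 : R) ^+ k by rewrite exprn_ge0.
  rewrite exprS; lra.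
exists l => //; apply/eqP; rewrite -subr_eq0; apply/eqP.
apply: (@geometric_norm_eq0 _ _ _
  (op_norm T * (C * 2 / (1 - 2^-1)) + 1) _ q01) => k.
rewrite (_ : T l - y = T (l - m k) - (y - T (m k))); last first.
  by rewrite linearB opprB addrA subrK.
rewrite (le_trans (ler_normB _ _))// mulrDl mul1r lerD//.
rewrite (le_trans (op_normP T _))// -[leRHS]mulrA ler_wpM2l ?op_norm_ge0//.
by rewrite (le_trans (lP k))// mulrAC.
Qed.

(** If the bi-adjoint sends [z] to [y] in [W], every [phi] vanishing on the range of [T] satisfies
    [phi y = z (adjoint T phi) = 0]. By separation [y = T m], and injectivity identifies [z] with
    [m]. *)
Lemma tauberian_of_injective_biadjoint : closed (range T) ->
  injective (biadjoint T) -> tauberian T.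
Proof.
move=> cT injT z [y _ yz].
have [m _ my] : range T y.
  apply: contrapT => nTy.
  have [||phi [phi0]] := hahn_banach_separation cT _ _ nTy.
  - by exists 0 => //; rewrite linear0.
  - by move=> a _ _ [u _ <-] [v _ <-]; exists (a *: u + v) => //; rewrite linearP.
  have -> : phi y = biadjoint T z phi by rewrite -yz.
  rewrite (_ : biadjoint T z phi = z (adjoint T phi))//.
  rewrite (_ : adjoint T phi = 0) ?linear0//.
  by apply: bop_ext => u; apply: phi0; exists u.
by exists m => //; apply: injT; rewrite -yz -my; exact: bop_ext.
Qed.

End bounded_below.

(** * Transfer of properties between f, \hat f and C_f *)

Section lipfree_map.
Context {R : realType} {M N : pMetricType R} (f : lip0 M N).
Local Notation T := (lipfree_map f).

Lemma bidual_emb_lipfree_inj : injective (@bidual_emb R (lipfree M)).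
Proof.
move=> m n mn; apply: val_inj; apply: bop_ext => g.
by have := congr1 (fun z : dual (dual (lipfree M)) => z (lip_eval g)) mn.
Qed.

Lemma lipfree_delta_inj : injective (@lipfree_delta R M).
Proof.
move=> x y xy; apply: mdist_positivity.
by rewrite -lipfree_norm_delta xy subrr normr0.
Qed.

Lemma biadjoint_inj_lipfree_map : injective (biadjoint T) -> injective T.
Proof.
move=> injT m n mn; apply: bidual_emb_lipfree_inj; apply: injT.
by apply: bop_ext => phi; rewrite -[LHS]/(phi (T m)) mn.
Qed.

Lemma lipfree_map_inj : injective T -> injective f.
Proof.
move=> injT x y xy; apply: lipfree_delta_inj; apply: injT.
by rewrite !lipfree_map_delta xy.
Qed.

Lemma bounded_below_bilipschitz C : 0 < C ->
  (forall m, `|m| <= C * `|T m|) -> bilipschitz f.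
Proof.
move=> C0 TC; have [[k [k0 kP]] _] := lip0P f.
exists C^-1, (k + 1); split=> [||x y]; rewrite ?invr_gt0//; first lra.
apply/andP; split.
  rewrite ler_pdivrMl// -(lipfree_norm_delta x) (le_trans (TC _))//.
  have -> : T (lipfree_delta x - lipfree_delta y) =
      T (lipfree_delta x) - T (lipfree_delta y) by exact: linearB.
  by rewrite !lipfree_map_delta lipfree_norm_delta.
by rewrite (le_trans (kP _ _))// ler_wpM2r ?mdist_ge0// lerDl.
Qed.

(** Each [g] in Lip_0(M) is C_f(h) with [|h| <= a^-1 * |g|], so [m] at [g] equals [T m] at [h]. *)
Lemma bilipschitz_bounded_below : bilipschitz f ->
  exists2 C, 0 < C & forall m, `|m| <= C * `|T m|.
Proof.
move=> [a [b [a0 _ fab]]]; have fa x y := proj1 (andP (fab x y)).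
exists a^-1 => [|m]; first by rewrite invr_gt0.
apply: best_const_lb => [|g]; first by rewrite mulr_ge0// invr_ge0 ltW.
have [h [<- hg]] := mcshane_comp_op g a0 fa.
rewrite -[X in `|X|]/(lipfree_val (T m) h).
rewrite (le_trans (op_normP (lipfree_val (T m)) h))// -mulrA mulrCA.
by rewrite ler_wpM2l ?op_norm_ge0.
Qed.

(** A functional killed by the bi-adjoint vanishes on the range of C_f, hence everywhere by
    continuity. *)
Lemma dense_range_biadjoint_inj :
  dense (range (comp_op f)) -> injective (biadjoint T).
Proof.
move=> dC; suff inj0 z : biadjoint T z = 0 -> z = 0.
  move=> z w zw; apply: subr0_eq; apply: inj0.
  apply: (etrans (linearB (biadjoint T) z w)).
  by apply/eqP; rewrite subr_eq0; apply/eqP.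
move=> z0; apply: bop_ext => phi.
have [g ->] := dual_lipfree_eval phi.
apply/eqP; rewrite -normr_le0; apply/ler_addgt0Pr => e e0; rewrite add0r.
have k1 : 0 < op_norm z + 1 by rewrite ltr_wpDl// op_norm_ge0.
have [|u [gu [h _ hE]]] := dC (ball g (e / (op_norm z + 1))) _ (@ball_open _ _ g _).
  by exists g; apply: ballxx; rewrite divr_gt0.
move: gu; rewrite -hE -ball_normE /= ltr_pdivlMr// => /ltW; apply: le_trans.
have -> : z (lip_eval g) = z (lip_eval (g - comp_op f h)).
  have -> : lip_eval (g - comp_op f h) = lip_eval g - lip_eval (comp_op f h).
    by apply: bop_ext => m; exact: (linearB (lipfree_val m)).
  rewrite linearB -adjoint_lip_eval.
  by rewrite -[X in _ - X]/(biadjoint T z (lip_eval h)) z0 subr0.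
rewrite (le_trans (op_normP _ _))// mulrC ler_pM// ?op_norm_ge0//.
  exact: lip_eval_norm.
by rewrite lerDl.
Qed.

End lipfree_map.

(** * Limits along ultrafilters *)

Section ultralimit.
Context {R : realType}.

Lemma ultra_bounded_cvg (I : Type) (U : set_system I) (a : I -> R) (K : R) :
  UltraFilter U -> (forall i, `|a i| <= K) -> exists l : R, a @ U --> l.
Proof.
move=> UU aK; have PU : ProperFilter U by exact: ultra_proper.
have : compact `[- K, K]%classic by exact: segment_compact.
move=> /(_ (a @ U) _)[|l [_ lcl]].
  by rewrite nbhs_filterE /fmap/=; apply: filterE => i /=; rewrite in_itv/= -ler_norml aK.
exists l; apply/cvgrPdist_lt => e e0.
have [//|nU] := in_ultra_setVsetC [set i | `|l - a i| < e] UU.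
have [b [/= lb bl]] := lcl [set t | ~ `|l - t| < e] _ nU (nbhsx_ballx l e e0).
by case: lb; rewrite -ball_normE in bl.
Qed.

(* A Ramsey-type selection: the pairwise relation holds along a sequence chosen
   greedily in a decreasing sequence of large sets. *)
Lemma filter_sequence (I : Type) (U : set_system I) (Q : I -> I -> Prop)
    (B : nat -> set I) : ProperFilter U -> (forall n, U (B n)) ->
  (\forall p \near U, \forall q \near U, Q p q) ->
  exists s : nat -> I, (forall n, B n (s n)) /\
    forall i n, (i < n)%N -> Q (s i) (s n).
Proof.
move=> PU UB UQ.
pose G : set I := [set p | \forall q \near U, Q p q].
(* [l] lists the points chosen so far, latest first. Keeping them all in [G] makes the set of
   admissible next points belong to [U]. *)
pose allG := fix allG l := if l is p :: l' then G p /\ allG l' else True.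
pose allQ := fix allQ l q := if l is p :: l' then Q p q /\ allQ l' q else True.
have allGQ l : allG l -> U (allQ l).
  elim: l => [|p l IH] /=; first by move=> _; exact: filterT.
  by move=> [Gp /IH Ul]; exact: filterI.
have /choice[next nextP] : forall nl : nat * seq I, exists q,
    allG nl.2 -> [/\ G q, B nl.1 q & allQ nl.2 q].
  move=> [n l]; have [/allGQ Ul|nG] := pselect (allG l); last first.
    by have [q _] := filter_ex UQ; exists q.
  have [q [[Gq Bq] lq]] := filter_ex (filterI (filterI UQ (UB n)) Ul).
  by exists q.
pose l := fix l n := if n is k.+1 then next (k, l k) :: l k else [::].
have lG n : allG (l n).
  by elim: n => //= n IH; split=> //; have [] := nextP (n, l n) IH.
exists (fun n => next (n, l n)); split=> [n|i n]; first by have [] := nextP (n, l n) (lG n).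
have [_ _] := nextP (n, l n) (lG n); move: (next (n, l n)) => q /=.
elim: n => // n IH [Qq /IH{}IH]; rewrite ltnS leq_eqVlt => /orP[/eqP -> //|].
exact: IH.
Qed.

(** [z] is a weak-* limit point of the sequence in the bidual, built pointwise; linearity and the
    norm bound pass to the limit. *)
Lemma ultralimit_functional (X : normedModType R) (m : nat -> X)
    (U : set_system nat) : UltraFilter U -> (forall n, `|m n| <= 1) ->
  exists z : dual (dual X), forall phi : dual X,
    (fun n => phi (m n) : R) @ U --> (z phi : R).
Proof.
move=> UU m1; have PU : ProperFilter U by exact: ultra_proper.
have phim (phi : dual X) n : `|phi (m n) : R| <= `|phi|.
  rewrite (le_trans (op_normP phi (m n)))// -[leRHS]mulr1 ler_wpM2l//.
  exact: op_norm_ge0.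
have /choice[z zP] : forall phi : dual X, exists l : R,
    (fun n => phi (m n) : R) @ U --> l.
  by move=> phi; exact: ultra_bounded_cvg (phim phi).
have linz : linear (z : dual X -> R^o).
  move=> a phi psi; have apz : (fun n => (a *: phi + psi) (m n) : R) @ U -->
      (a * z phi + z psi : R).
    rewrite (_ : (fun n => _) = fun n => a * (phi (m n) : R) + (psi (m n) : R))//.
    have aphi : (fun n => a * (phi (m n) : R)) @ U --> (a * z phi : R).
      exact: cvgMl_tmp (zP phi).
    exact: cvgD aphi (zP psi).
  exact: (cvg_unique (@Rhausdorff R) (zP _) apz).
have bz : exists k, 0 <= k /\ forall phi, `|(z : dual X -> R^o) phi| <= k * `|phi|.
  exists 1; split=> // phi; rewrite mul1r.
  by apply: (cvgr_to_le (cvg_norm (zP phi))); exact: filterE.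
by exists (mk_bop linz bz).
Qed.

End ultralimit.

(** * Bump functions detecting a limit of molecules *)

Section bumps.
Context {R : realType} {M : pMetricType R} (x y : nat -> M) (c : R).
Hypothesis c0 : 0 < c.
Hypothesis x_far : forall p, exists k, forall i, (k <= i)%N ->
  c * mdist (x i) (y i) <= mdist p (x i).
Hypothesis y_far : forall i n,
  c * mdist (x i) (y i) - mdist (y n) (x i) <= c / 2 * mdist (x n) (y n).

(** [g k] is the supremum over [i >= k] of the tents [max (0, c * d i - d(p, x i))], shifted to
    vanish at the base point. By [x_far] only finitely many tents are nonzero at a given point;
    before the shift, the value at [x n] is at least [c * d n], while [y_far] caps the value at
    [y n] by half of that. *)
Lemma pointwise_null_bumps : exists g : nat -> lip0 M R^o,
  [/\ forall k p q, `|g k p - g k q| <= mdist p q,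
      forall p, exists k0, forall k, (k0 <= k)%N -> g k p = 0 &
      forall k n, (k <= n)%N ->
        c / 2 * mdist (x n) (y n) <= g k (x n) - g k (y n)].
Proof.
pose d n := mdist (x n) (y n).
have d0 n : 0 <= c * d n by rewrite mulr_ge0 ?mdist_ge0// ltW.
pose b i p := Num.max 0 (c * d i - mdist p (x i)).
have b0 i p : 0 <= b i p by rewrite le_max lexx.
have b_le i p t : 0 <= t -> c * d i - mdist p (x i) <= t -> b i p <= t.
  by move=> t0 bt; rewrite ge_max t0.
have b_ge i p : c * d i - mdist p (x i) <= b i p by rewrite le_max lexx orbT.
pose S k p := [set b i p | i in [set i | (k <= i)%N]].
have S0 k p : S k p !=set0 by exists (b k p), k => /=.
have Sub k p : has_ubound (S k p).
  (* All tents are bounded at [y 0] by [y_far], and they are 1-Lipschitz. *)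
  exists (c / 2 * d 0%N + mdist p (y 0%N)) => _ [i _ <-]; apply: b_le.
    by rewrite addr_ge0 ?mdist_ge0// mulrAC divr_ge0.
  have := y_far i 0; have := metric_triangle (y 0) p (x i).
  rewrite (metric_sym (y 0) p) /d; lra.
pose h k p := sup (S k p).
have h_ge k i p : (k <= i)%N -> b i p <= h k p.
  by move=> ki; apply: ub_le_sup => //; exists i.
have h_le k p t : (forall i, (k <= i)%N -> b i p <= t) -> h k p <= t.
  by move=> ht; apply: ge_sup => // _ [i ki <-]; exact: ht.
have hL k p q : h k p - h k q <= mdist p q.
  rewrite lerBlDr; apply: h_le => i ki; apply: b_le.
    by rewrite addr_ge0 ?mdist_ge0// (le_trans (b0 i q)) ?h_ge.
  have := metric_triangle q p (x i); rewrite (metric_sym q p).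
  by have := le_trans (b_ge i q) (h_ge k i q ki); lra.
have hL' k p q : `|h k p - h k q| <= mdist p q.
  by rewrite ler_norml lerNl opprB hL andbT metric_sym hL.
have h0 p : exists k0, forall k, (k0 <= k)%N -> h k p = 0.
  have [k0 k0P] := x_far p; exists k0 => k k0k; apply/eqP; rewrite eq_le.
  rewrite (le_trans (b0 k p)) ?h_ge// andbT h_le// => i ki.
  by rewrite b_le// subr_le0; exact: k0P (leq_trans k0k ki).
have gP k : is_lip0 (fun p : M => h k p - h k point : R^o).
  split; last by rewrite subrr.
  exists 1; split=> // p q; rewrite mdist_real mul1r opprB addrA subrK.
  exact: hL'.
exists (fun k => mk_lip0 (gP k)).
have gB k p q : mk_lip0 (gP k) p - mk_lip0 (gP k) q = h k p - h k q.
  rewrite -[LHS]/((h k p - h k point) - (h k q - h k point)); lra.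
split=> [k p q|p|k n kn].
- by rewrite gB.
(* The shift [h k point] is itself 0 for large [k]. *)
- have [k0 k0P] := h0 p; have [k1 k1P] := h0 point.
  exists (maxn k0 k1) => k; rewrite geq_max => /andP[k0k k1k].
  by rewrite -[LHS]/(h k p - h k point) k0P// k1P// subrr.
- rewrite gB.
  have : h k (y n) <= c / 2 * d n.
    have cd : 0 <= c / 2 * d n by rewrite mulrAC divr_ge0.
    by apply: h_le => i ki; exact: b_le cd (y_far i n).
  have := le_trans (b_ge n (x n)) (h_ge k n (x n) kn).
  by rewrite mdistxx -/(d n); lra.
Qed.

End bumps.

(** * A kernel element outside F(M) from sparse pairs *)

Section core.
Context {R : realType} {M N : pMetricType R} (f : lip0 M N).

(** The failure of the kernel inclusion in (ii), given by a witness. *)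
Definition biadjoint_kernel_escapes := exists2 z,
  biadjoint (lipfree_map f) z = 0 & ~ range (@bidual_emb R (lipfree M)) z.

Lemma sparse_pairs_kernel_escapes (x y : nat -> M) (c : R) : 0 < c ->
  (forall n, mdist (f (x n)) (f (y n)) < n.+1%:R^-1 * mdist (x n) (y n)) ->
  (forall p, exists k, forall i, (k <= i)%N ->
    c * mdist (x i) (y i) <= mdist p (x i)) ->
  (forall i n,
    c * mdist (x i) (y i) - mdist (y n) (x i) <= c / 2 * mdist (x n) (y n)) ->
  biadjoint_kernel_escapes.
Proof.
move=> c0 fxy x_far y_far.
pose d n := mdist (x n) (y n).
have d0 n : 0 < d n.
  rewrite lt_neqAle mdist_ge0 andbT; apply/eqP => dn.
  have := fxy n; rewrite -/(d n) -dn mulr0.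
  by rewrite ltNge mdist_ge0.
pose m n := (d n)^-1 *: (lipfree_delta (x n) - lipfree_delta (y n)).
have m1 n : `|m n| <= 1.
  by rewrite normrZ lipfree_norm_delta normfV gtr0_norm// mulVf// gt_eqF.
have [U [UU Uoo]] := ultraFilterLemma (eventually_filter : ProperFilter \oo).
have PU : ProperFilter U by exact: ultra_proper.
have [z zP] := ultralimit_functional UU m1.
exists z.
  apply: bop_ext => psi; apply/eqP; rewrite -normr_le0.
  have zT : (fun n => psi (lipfree_map f (m n)) : R) @ U -->
      (biadjoint (lipfree_map f) z psi : R) by exact: (zP (adjoint _ psi)).
  apply/ler_addgt0Pr => e e0; rewrite add0r.
  apply: (cvgr_to_le (cvg_norm zT)).
  apply: Uoo.
  (* From this rank on, [|psi| / (n + 1) <= e]. *)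
  pose n0 := (Num.truncn (op_norm psi / e)).+1.
  exists n0 => // n /= n0n.
  apply: le_trans (op_normP psi (lipfree_map f (m n))) _.
  have fm : `|lipfree_map f (m n)| <= n.+1%:R^-1.
    have -> : lipfree_map f (m n) =
        (d n)^-1 *: (lipfree_delta (f (x n)) - lipfree_delta (f (y n))).
      by rewrite -!lipfree_map_delta /m linearZ linearB.
    rewrite normrZ lipfree_norm_delta normfV gtr0_norm//.
    by rewrite mulrC ler_pdivrMr//; apply/ltW/fxy.
  apply: le_trans (ler_wpM2l (op_norm_ge0 psi) fm) _.
  rewrite ler_pdivrMr// -ler_pdivrMl// mulrC.
  have := truncnS_gt (op_norm psi / e); rewrite -/n0 => /ltW/le_trans; apply.
  by rewrite ler_nat (leq_trans n0n).
move=> [w _ wz].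
have [g [gL g0 gxy]] := pointwise_null_bumps c0 x_far y_far.
(* A finite combination within [c / 4] of [w] vanishes on [g k] for large [k], so [w] is at most
   [c / 4] there, whereas the limit of the molecules is at least [c / 2]. *)
have c40 : 0 < c / 4 by lra.
have [s ws] := lipfree_approx w c40.
have [k sk] : exists k, forall n, (k <= n)%N ->
    \sum_(p <- s) p.1 * g n p.2 = 0.
  elim: s {ws} => [|p s [k kP]]; first by exists 0%N => n _; rewrite big_nil.
  have [k0 k0P] := g0 p.2; exists (maxn k0 k) => n.
  by rewrite geq_max big_cons => /andP[/k0P -> /kP ->]; rewrite mulr0 addr0.
have wg : lipfree_val w (g k) <= c / 4.
  apply: le_trans (ler_norm _) _.
  have -> : lipfree_val w (g k) = lipfree_val
      (w - \sum_(p <- s) p.1 *: lipfree_delta p.2) (g k).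
    have gs : lip_eval (g k) (\sum_(p <- s) p.1 *: lipfree_delta p.2) = 0.
      by rewrite linear_sum -[RHS](sk k (leqnn k)); apply: eq_bigr => p _; rewrite linearZ.
    have gB u v : lip_eval (g k) (u - v) = lip_eval (g k) u - lip_eval (g k) v.
      exact: linearB.
    by rewrite -[RHS]/(lip_eval (g k) _) gB gs subr0.
  apply: le_trans (@lipfree_le_norm _ _ _ _ 1 _ ler01) _.
    by move=> p q; rewrite mul1r gL.
  by rewrite mul1r ltW.
have : c / 2 <= lipfree_val w (g k).
  have -> : lipfree_val w (g k) = z (lip_eval (g k)) by rewrite -wz.
  apply: (cvgr_to_ge (zP (lip_eval (g k)))); apply: Uoo; exists k => // n kn /=.
  change (c / 2 <= (d n)^-1 * (g k (x n) - g k (y n))).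
  by rewrite ler_pdivlMl// mulrC gxy.
lra.
Qed.

End core.

(** * Selection of sparse pairs *)

Section cases.
Context {R : realType} {M N : pMetricType R} (f : lip0 M N).
Implicit Types U : set_system (M * M).

(** The ratio d(f x, f y) / d(x, y) tends to 0 along [U]; the strict product form also forces x and
    y to differ. *)
Definition contracting U := forall e : R, 0 < e ->
  \forall p \near U, mdist (f p.1) (f p.2) < e * mdist p.1 p.2.

Lemma contracting_swap U : Filter U -> contracting U ->
  contracting ((fun p => (p.2, p.1)) @ U).
Proof.
move=> FU Uc e e0; apply: (filterS _ (Uc e e0)) => p /=.
by rewrite metric_sym [X in _ * X]metric_sym.
Qed.

Lemma contracting_gt0 U : Filter U -> contracting U ->
  \forall p \near U, 0 < mdist p.1 p.2.
Proof.
move=> FU Uc; apply: filterS (Uc 1 ltr01) => p; rewrite mul1r.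
exact/le_lt_trans/mdist_ge0.
Qed.

(** Select pairs whose distances at least double and whose x leaves the earlier y far behind. As
    d(x, y) <= 2 d(x, 0), the constant 1/4 works: later tents vanish at [y n], and earlier ones are
    at most half as high as the n-th. *)
Lemma contracting_unbounded U : ProperFilter U -> contracting U ->
  (forall D, \forall p \near U, D <= mdist p.1 p.2) ->
  (\forall p \near U, mdist p.2 point <= mdist p.1 point) ->
  biadjoint_kernel_escapes f.
Proof.
move=> PU Uc Uoo Uxy.
have half (p : M * M) : mdist p.2 point <= mdist p.1 point ->
    mdist p.1 p.2 <= 2 * mdist p.1 point.
  by have := metric_triangle p.1 point p.2; rewrite (metric_sym point); lra.
pose B n := [set p : M * M | [/\
  mdist (f p.1) (f p.2) < n.+1%:R^-1 * mdist p.1 p.2,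
  n%:R <= mdist p.1 p.2 & mdist p.2 point <= mdist p.1 point]].
pose Q (p q : M * M) := 2 * mdist p.1 p.2 <= mdist q.1 q.2 /\
  2 * mdist p.2 point <= mdist q.1 point.
have UB n : U (B n).
  have e0 : 0 < n.+1%:R^-1 :> R by rewrite invr_gt0.
  have h1 := Uc _ e0; have h2 := Uoo n%:R.
  by apply: filterS3 h1 h2 Uxy.
have UQ : \forall p \near U, \forall q \near U, Q p q.
  apply: filterE => p.
  have h1 := Uoo (2 * mdist p.1 p.2); have h2 := Uoo (4 * mdist p.2 point).
  apply: filterS3 h1 h2 Uxy => q q1 q2 /half q3; split=> //.
  lra.
have [s [sB sQ]] := filter_sequence PU UB UQ.
apply: (@sparse_pairs_kernel_escapes _ _ _ f (fun n => (s n).1) (fun n => (s n).2) 4^-1).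
- by rewrite invr_gt0.
- by move=> n; have [] := sB n.
- move=> p /=; exists (Num.truncn (4 * mdist p point)).+1 => i ki.
  have [_ si /half xi] := sB i.
  have : 4 * mdist p point <= i%:R.
    by rewrite (le_trans (ltW (truncnS_gt _)))// ler_nat.
  have := metric_triangle (s i).1 p point; rewrite (metric_sym _ p).
  lra.
- move=> i n /=; have h := mdist_ge0 (s n).2 (s i).1.
  have di := mdist_ge0 (s i).1 (s i).2.
  have [lt_in|lt_ni|->] := ltngtP i n.
  + by have [+ _] := sQ _ _ lt_in; lra.
  + have [_ ?] := sQ _ _ lt_ni; have [_ _ /half ?] := sB i.
    have := metric_triangle (s i).1 (s n).2 point.
    have := mdist_ge0 (s n).1 (s n).2.
    rewrite (metric_sym (s i).1 (s n).2); lra.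
  + by rewrite (metric_sym (s n).2); have := mdist_ge0 (s n).1 (s n).2; lra.
Qed.

(** The mirror image of the unbounded case, with distances to [a] and shrinking pairs: earlier tents
    vanish at [y n], and later ones are at most half as high as the n-th. *)
Lemma contracting_cvg U (a : M) : ProperFilter U -> contracting U ->
  (forall e, 0 < e -> \forall p \near U, mdist p.1 a < e) ->
  (\forall p \near U, mdist p.2 a <= mdist p.1 a) ->
  biadjoint_kernel_escapes f.
Proof.
move=> PU Uc Ua Uxy.
have half (p : M * M) : mdist p.2 a <= mdist p.1 a ->
    mdist p.1 p.2 <= 2 * mdist p.1 a.
  by have := metric_triangle p.1 a p.2; rewrite (metric_sym a); lra.
pose B n := [set p : M * M | [/\
  mdist (f p.1) (f p.2) < n.+1%:R^-1 * mdist p.1 p.2,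
  mdist p.1 a < n.+1%:R^-1 & mdist p.2 a <= mdist p.1 a]].
pose Q (p q : M * M) := 2 * mdist q.1 q.2 <= mdist p.1 p.2 /\
  4 * mdist q.2 a <= mdist p.1 p.2.
have UB n : U (B n).
  have e0 : 0 < n.+1%:R^-1 :> R by rewrite invr_gt0.
  have h1 := Uc _ e0; have h2 := Ua _ e0.
  by apply: filterS3 h1 h2 Uxy.
have UQ : \forall p \near U, \forall q \near U, Q p q.
  apply: filterS (contracting_gt0 _ Uc) => p p0.
  have e0 : 0 < mdist p.1 p.2 / 4 by rewrite divr_gt0.
  apply: filterS2 (Ua _ e0) Uxy => q q1 q2; have q3 := half _ q2; rewrite /Q; lra.
have [s [sB sQ]] := filter_sequence PU UB UQ.
apply: (@sparse_pairs_kernel_escapes _ _ _ f (fun n => (s n).1) (fun n => (s n).2) 4^-1).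
- by rewrite invr_gt0.
- by move=> n; have [] := sB n.
- move=> p /=; have [->|pa] := eqVneq p a.
    exists 0%N => i _; have [_ _ /half] := sB i; rewrite (metric_sym a).
    by have := mdist_ge0 (s i).1 a; lra.
  have pa0 : 0 < mdist p a by rewrite mdist_gt0.
  exists (Num.truncn (2 / mdist p a)) => i ki.
  have [_ si /half xi] := sB i.
  have : i.+1%:R^-1 <= mdist p a / 2.
    rewrite -[leRHS]invf_div lef_pV2 ?posrE ?divr_gt0//.
    by rewrite (le_trans (ltW (truncnS_gt _)))// ler_nat.
  by move=> /(lt_le_trans si); have := metric_triangle p (s i).1 a; lra.
- move=> i n /=; have h := mdist_ge0 (s n).2 (s i).1.
  have di := mdist_ge0 (s i).1 (s i).2.
  have [lt_in|lt_ni|->] := ltngtP i n.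
  + have [_ ?] := sQ _ _ lt_in; have [_ _ /half ?] := sB i.
    have := metric_triangle (s i).1 (s n).2 a.
    have := mdist_ge0 (s n).1 (s n).2.
    rewrite (metric_sym (s i).1 (s n).2); lra.
  + by have [+ _] := sQ _ _ lt_ni; lra.
  + by rewrite (metric_sym (s n).2); have := mdist_ge0 (s n).1 (s n).2; lra.
Qed.

(** The tents can be made so low that all of them vanish at every [y n]. *)
Lemma contracting_separated U (D e r : R) : ProperFilter U -> contracting U ->
  0 < e -> 0 < r -> (\forall p \near U, mdist p.1 p.2 <= D) ->
  (forall a, \forall p \near U, e <= mdist a p.1) ->
  (\forall p \near U, \forall q \near U, r <= mdist q.2 p.1) ->
  biadjoint_kernel_escapes f.
Proof.
move=> PU Uc e0 r0 UD Ux Uy.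
have D0 : 0 < D.
  have [p [pD p0]] := filter_ex (filterI UD (contracting_gt0 _ Uc)).
  exact: lt_le_trans p0 pD.
pose B n := [set p : M * M |
  mdist (f p.1) (f p.2) < n.+1%:R^-1 * mdist p.1 p.2 /\ mdist p.1 p.2 <= D].
pose Q (p q : M * M) :=
  [/\ e <= mdist p.1 q.1, e <= mdist p.2 q.1 & r <= mdist q.2 p.1].
have UB n : U (B n).
  have d0 : 0 < n.+1%:R^-1 :> R by rewrite invr_gt0.
  exact: filterI (Uc _ d0) UD.
have UQ : \forall p \near U, \forall q \near U, Q p q.
  apply: filterS Uy => p py.
  by apply: filterS3 (Ux p.1) (Ux p.2) py.
have [s [sB sQ]] := filter_sequence PU UB UQ.
pose t := Num.min r (e / 2).
have t0 : 0 < t by rewrite lt_min r0 divr_gt0.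
have tr : t <= r by rewrite ge_min lexx.
have te : t <= e / 2 by rewrite ge_min lexx orbT.
(* This keeps every tent height [c * d i] at most [t], and [c <= 1] handles [i = n]. *)
pose c := t / (t + D).
have tD : 0 < t + D by rewrite addr_gt0.
have c0 : 0 < c by rewrite divr_gt0.
have c1 : c <= 1 by rewrite ler_pdivrMr// mul1r lerDl ltW.
have cd i : c * mdist (s i).1 (s i).2 <= t.
  have [_ di] := sB i; apply: le_trans (ler_wpM2l (ltW c0) di) _.
  by rewrite mulrAC ler_pdivrMr// ler_wpM2l ?ltW// ltrDr.
apply: (@sparse_pairs_kernel_escapes _ _ _ f (fun n => (s n).1) (fun n => (s n).2) c) => //.
- by move=> n; have [] := sB n.
(* A point within [e / 2] of some [x j] is at least [e / 2] away from all later ones. *)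
- move=> p /=; have [[j pj]|nj] := pselect (exists j, mdist p (s j).1 < e / 2).
    exists j.+1 => i ji; apply: le_trans (cd i) _; apply: le_trans te _.
    have [+ _ _] := sQ _ _ ji.
    have := metric_triangle (s j).1 p (s i).1; rewrite (metric_sym _ p); lra.
  exists 0%N => i _; apply: le_trans (cd i) _; apply: le_trans te _.
  by rewrite leNgt; apply/negP => pi; apply: nj; exists i.
- move=> i n.
  have : 0 <= c / 2 * mdist (s n).1 (s n).2.
    by rewrite mulr_ge0 ?mdist_ge0// divr_ge0// ltW.
  apply: le_trans; rewrite subr_le0.
  have [lt_in|lt_ni|->] := ltngtP i n.
  + by have [_ _] := sQ _ _ lt_in; apply/le_trans/(le_trans (cd i)).
  + have [_ h _] := sQ _ _ lt_ni; apply: le_trans h.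
    by apply: le_trans (cd i) _; lra.
  + by rewrite (metric_sym (s n).2) ler_piMl ?mdist_ge0.
Qed.

End cases.

(** * Case analysis for maps that are not bi-Lipschitz *)

Section not_bilipschitz.
Context {R : realType}.

(** If every radius has a ball that is large for the image ultrafilter, that filter is Cauchy and
    converges by completeness; otherwise, for some radius, the complement of every ball is large. *)
Lemma ultra_cvg_or_separated (M : completePMetricType R) (I : Type)
    (U : set_system I) (g : I -> M) : UltraFilter U ->
  (exists a, forall e, 0 < e -> \forall p \near U, mdist (g p) a < e) \/
  (exists2 e, 0 < e & forall a, \forall p \near U, e <= mdist a (g p)).
Proof.
move=> UU; have PU : ProperFilter U by exact: ultra_proper.
have [|nsep] := pselect (exists2 e, 0 < e & forall a,
  \forall p \near U, e <= mdist a (g p)); [by right|left].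
have gc : cauchy_ex (g @ U).
  move=> e e0; apply: contrapT => noa; apply: nsep; exists e => // a.
  have [Ua|] := in_ultra_setVsetC [set p | mdist a (g p) < e] UU.
    by exfalso; apply: noa; exists a; rewrite ballEmdist.
  by apply: filterS => p /= /negP; rewrite -leNgt.
have /cvg_ex[a ga] : cvg (g @ U) by apply: cauchy_cvg; exact: cauchy_exP gc.
exists a => e e0.
have : U [set p | ball a e (g p)] := ga _ (nbhsx_ballx a e e0).
by apply: filterS => p; rewrite ballEmdist /= metric_sym.
Qed.

Context {M : completePMetricType R} {N : pMetricType R} (f : lip0 M N).

(** The sets [A e] form a filter base: an empty [A e] would make [e] a lower Lipschitz constant. Any
    ultrafilter refining it will do. *)
Lemma not_bilipschitz_contracting : ~ bilipschitz f ->
  exists U : set_system (M * M), UltraFilter U /\ contracting f U.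
Proof.
move=> nf; have [[k [k0 kP]] _] := lip0P f.
pose A (e : R) := [set p : M * M | mdist (f p.1) (f p.2) < e * mdist p.1 p.2].
have AF : ProperFilter (filter_from [set e : R | 0 < e] A).
  apply: filter_from_proper.
    apply: filter_from_filter; first by exists 1 => /=.
    move=> e1 e2 /= e10 e20; exists (Num.min e1 e2); first by rewrite /= lt_min e10.
    by move=> p; rewrite /A/= minr_pMl ?mdist_ge0// lt_min => /andP[].
  move=> e /= e0; apply: contrapT => Ae; apply: nf.
  exists e, (k + 1); split=> [||x y]; rewrite ?ltr_wpDl//.
  apply/andP; split; last first.
    by rewrite (le_trans (kP _ _))// ler_wpM2r ?mdist_ge0// lerDl.
  by rewrite leNgt; apply/negP => xy; apply: Ae; exists (x, y).
have [U [UU AU]] := ultraFilterLemma AF; exists U; split=> // e e0.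
by apply: AU; exists e.
Qed.

(** Along [U], d(x, y) tends to infinity or stays bounded. If bounded, each coordinate converges or
    is separated, and two limits must coincide by contraction and injectivity. Up to exchanging
    coordinates, the three selection lemmas cover all cases. *)
Lemma not_bilipschitz_kernel_escapes : injective f -> ~ bilipschitz f ->
  biadjoint_kernel_escapes f.
Proof.
move=> injf /not_bilipschitz_contracting[U [UU Uc]].
have PU : ProperFilter U by exact: ultra_proper.
pose U' := (fun p : M * M => (p.2, p.1)) @ U.
have PU' : ProperFilter U' by exact: fmap_proper_filter.
have Uc' : contracting f U' by exact: contracting_swap.
have ultra (P : set (M * M)) : U P \/ U (~` P) by exact: in_ultra_setVsetC.
have total (g h : M * M -> R) : (\forall p \near U, g p <= h p) \/
    (\forall p \near U, h p <= g p).
  have [gh|hg] := ultra [set p | g p <= h p]; [by left|right].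
  by apply: filterS hg => p /= /negP; rewrite -ltNge => /ltW.
have [[D UD]|noD] := pselect (exists D, \forall p \near U, mdist p.1 p.2 <= D);
    last first.
  have Uoo D : \forall p \near U, D <= mdist p.1 p.2.
    have [UD|] := ultra [set p | mdist p.1 p.2 <= D]; first by case: noD; exists D.
    by apply: filterS => p /= /negP; rewrite -ltNge => /ltW.
  have [yx|xy] := total (fun p => mdist p.2 point) (fun p => mdist p.1 point).
    exact: contracting_unbounded Uc Uoo yx.
  apply: (@contracting_unbounded _ _ _ f U') => // D.
  by apply: filterS (Uoo D) => p; rewrite metric_sym.
have [[a xa]|[e e0 xe]] := ultra_cvg_or_separated (fun p : M * M => p.1) UU;
    have [[b yb]|[r r0 yr]] := ultra_cvg_or_separated (fun p : M * M => p.2) UU.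
- have ab : a = b.
    apply: injf; apply: mdist_positivity; apply/eqP.
    rewrite eq_le mdist_ge0 andbT; apply/ler_addgt0Pr => e e0; rewrite add0r.
    have [[k [k0 kP]] _] := lip0P f.
    (* d(f a, f b) is at most [k * d + d * |D| + k * d], going through a pair that is [d]-close to
       the limits. *)
    have D0 : 0 < k + k + `|D| + 1 by rewrite ltr_wpDl// !addr_ge0.
    have [d d0 <-] : exists2 d, 0 < d & d * (k + k + `|D| + 1) = e.
      exists (e / (k + k + `|D| + 1)); first by rewrite divr_gt0.
      by rewrite divfK// gt_eqF.
    have [p [[pa pb] [pf pD]]] := filter_ex (filterI
      (filterI (xa _ d0) (yb _ d0)) (filterI (Uc _ d0) UD)).
    have t1 := metric_triangle (f a) (f p.1) (f b).
    have t2 := metric_triangle (f p.1) (f p.2) (f b).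
    rewrite metric_sym in pa.
    have k1 := le_trans (kP a p.1) (ler_wpM2l k0 (ltW pa)).
    have k2 := le_trans (kP p.2 b) (ler_wpM2l k0 (ltW pb)).
    have k3 := ler_wpM2l (ltW d0) (le_trans pD (ler_norm D)).
    lra.
  subst b.
  have [yx|xy] := total (fun p => mdist p.2 a) (fun p => mdist p.1 a).
    exact: contracting_cvg Uc xa yx.
  exact: (@contracting_cvg _ _ _ f U' a PU' Uc' yb xy).
(* The separated coordinate has to come first, hence the swap; the other one ends up within [r / 2]
   of its limit [a]. *)
- apply: (@contracting_separated _ _ _ f U' D r (r / 2)) => //.
  + by rewrite divr_gt0.
  + by apply: filterS UD => p; rewrite metric_sym.
  + apply: filterS (yr a) => p rp.
    have r20 : 0 < r / 2 by rewrite divr_gt0.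
    apply: filterS (xa _ r20) => q /= qa.
    by have := metric_triangle a q.1 p.2; rewrite (metric_sym a q.1); lra.
- apply: (@contracting_separated _ _ _ f U D e (e / 2)) => //.
  + by rewrite divr_gt0.
  + apply: filterS (xe b) => p ep.
    have e20 : 0 < e / 2 by rewrite divr_gt0.
    apply: filterS (yb _ e20) => q /= qb.
    by have := metric_triangle b q.2 p.1; rewrite (metric_sym b q.2); lra.
- apply: (@contracting_separated _ _ _ f U D e r) => //.
  apply: filterE => p; apply: filterS (yr p.1) => q.
  by rewrite metric_sym.
Qed.

End not_bilipschitz.

(** * Closing the cycle of equivalences *)

Theorem corollary6p2 (R : realType) (M N : completePMetricType R)
    (f : lip0 M N) :
  [<->
    (* (i) *)
    injective (biadjoint (lipfree_map f));
    (* (ii) *)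
    injective f /\
      [set z | biadjoint (lipfree_map f) z = 0] `<=`
        range (@bidual_emb R (lipfree M));
    (* (iii) *)
    injective f /\ tauberian (lipfree_map f);
    (* (iv) *)
    bilipschitz f;
    (* (v) *)
    injective (lipfree_map f) /\ closed (range (lipfree_map f));
    (* (vi) *)
    range (comp_op f) = [set: lip0 M R^o];
    (* (vii) *)
    dense (range (comp_op f))].
Proof.
have T0 : biadjoint (lipfree_map f) 0 = 0 by exact: linear0.
have i_ii : injective (biadjoint (lipfree_map f)) -> injective f /\
    [set z | biadjoint (lipfree_map f) z = 0] `<=`
      range (@bidual_emb R (lipfree M)).
  move=> injT; split; first exact/lipfree_map_inj/biadjoint_inj_lipfree_map.
  move=> z z0; exists 0 => //.
  have -> : z = 0 by apply: injT; rewrite T0; exact: z0.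
  by apply: bop_ext => phi; exact: linear0.
have ii_iv : injective f /\ [set z | biadjoint (lipfree_map f) z = 0] `<=`
      range (@bidual_emb R (lipfree M)) -> bilipschitz f.
  move=> [injf kerT]; apply: contrapT => /(not_bilipschitz_kernel_escapes injf).
  by move=> [z z0]; apply; exact: kerT.
have iv_v : bilipschitz f -> injective (lipfree_map f) /\
    closed (range (lipfree_map f)).
  move=> /bilipschitz_bounded_below[C C0 TC]; split.
    move=> m n mn; apply: subr0_eq; apply/eqP; rewrite -normr_le0.
    have Tmn : lipfree_map f (m - n) = 0.
      by apply: (etrans (linearB _ _ _)); apply/eqP; rewrite subr_eq0; apply/eqP.
    by rewrite (le_trans (TC _))// Tmn normr0 mulr0.
  exact: bounded_below_closed_range (@geometrically_complete_lipfree _ _) (ltW C0) TC.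
have v_iv : injective (lipfree_map f) /\ closed (range (lipfree_map f)) ->
    bilipschitz f.
  move=> [injT cT].
  have [C C0 TC] := closed_range_bounded_below
    (@geometrically_complete_lipfree _ _) (@geometrically_complete_lipfree _ _)
    injT cT.
  exact: bounded_below_bilipschitz C0 TC.
have iv_vi : bilipschitz f -> range (comp_op f) = [set: lip0 M R^o].
  move=> [a [b [a0 _ fab]]]; apply/seteqP; split=> // g _.
  have [h [hg _]] := mcshane_comp_op g a0 (fun x y => proj1 (andP (fab x y))).
  by exists h.
have vi_vii : range (comp_op f) = [set: lip0 M R^o] -> dense (range (comp_op f)).
  by move=> -> O [g Og] _; exists g.
have vii_i := @dense_range_biadjoint_inj _ _ _ f.
tfae => //.
(* (ii) => (iii): via (iv), C_f is onto, so the bi-adjoint is injective, and \hat f has closed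
   range. *)
- move=> /ii_iv fbi; split.
    exact/lipfree_map_inj/biadjoint_inj_lipfree_map/vii_i/vi_vii/iv_vi.
  apply: tauberian_of_injective_biadjoint; first exact: (iv_v fbi).2.
  exact/vii_i/vi_vii/iv_vi.
(* (iii) => (iv): the kernel of the bi-adjoint is sent to 0, which lies in F(N), so tauberian
   implies the inclusion in (ii). *)
- move=> [injf tT]; apply: ii_iv; split=> // z z0; apply: tT.
  exists 0 => //; rewrite (z0 : biadjoint (lipfree_map f) z = 0).
  by apply: bop_ext => phi; exact: linear0.
- by move=> /v_iv.
Qed.
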